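(* Let $(\Omega,\mathcal{F},\mathsf{P})$ be atomless and let $u$ be a coherent utility on $L^0$ with determining set $\mathcal{D}$. The following are equivalent: (i) $u$ is law invariant; (ii) $\mathcal{D}$ is law invariant, i.e. if $Z\in\mathcal{D}$ and $Z'$ has the same distribution as $Z$ (as random variables under $\mathsf{P}$), then $Z'\in\mathcal{D}$; (iii) there exists a set $\mathfrak{M}$ of probability measures on $(0,1]$ such that $u(X)=\inf_{\mu\in\mathfrak{M}}u_\mu(X)$ for all $X\in L^0$; (iv) there exists a set $\mathfrak{M}$ of probability measures on $(0,1]$ such that $\mathcal{D}=\bigcup_{\mu\in\mathfrak{M}}\mathcal{D}_\mu$.
   Context: Let $(\Omega,\mathcal{F},\mathsf{P})$ be a probability space, $L^0$ the space of all real random variables, and $\mathcal{P}$ the set of probability measures on $\mathcal{F}$ absolutely continuous with respect to $\mathsf{P}$; measures are identified with their densities $Z=d\mathsf{Q}/d\mathsf{P}$. For $\mathsf{Q}\in\mathcal{P}$, $\mathsf{E}_\mathsf{Q}X:=\mathsf{E}_\mathsf{Q}X^+-\mathsf{E}_\mathsf{Q}X^-$ with the convention $\infty-\infty=-\infty$. A coherent utility on $L^0$ is a map $u:L^0\to[-\infty,\infty]$ of the form $u(X)=\inf_{\mathsf{Q}\in\mathcal{D}}\mathsf{E}_\mathsf{Q}X$ for a nonempty $\mathcal{D}\subseteq\mathcal{P}$; its determining set is the largest such set, $\{\mathsf{Q}\in\mathcal{P}:\mathsf{E}_\mathsf{Q}X\ge u(X)\ \forall X\in L^0\}$. $u$ is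 law invariant if $u(X)=u(X')$ whenever $X,X'$ have the same distribution. For $\lambda\in(0,1]$, $u_\lambda(X)=\inf\{\mathsf{E}_\mathsf{Q}X:\mathsf{Q}\in\mathcal{P},\ d\mathsf{Q}/d\mathsf{P}\le\lambda^{-1}\}$. For a probability measure $\mu$ on $(0,1]$, $u_\mu(X)=\int_{(0,1]}u_\lambda(X)\mu(d\lambda)$, $X\in L^0$, where $\int f\,d\mu:=\int f^+d\mu-\int f^-d\mu$ with $\infty-\infty=-\infty$; $u_\mu$ (Weighted V@R utility) is a coherent utility on $L^0$, and $\mathcal{D}_\mu$ denotes its determining set. *)

(* Defs.v *)
From HB Require Import structures.
From mathcomp Require Import all_boot all_order all_algebra.
From mathcomp Require Import all_classical all_reals all_analysis.
Set Implicit Arguments. Unset Strict Implicit. Unset Printing Implicit Defensive.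
Import Order.TTheory GRing.Theory Num.Theory.
Local Open Scope classical_set_scope.
Local Open Scope ring_scope.
Local Open Scope ereal_scope.

Section Defs.
Context {d : measure_display} {T : measurableType d} {R : realType}.
Variable P : probability T R.

Definition atomless : Prop :=
  forall A : set T, measurable A -> (0 < P A)%E ->
    exists B : set T, [/\ measurable B, B `<=` A, (0 < P B)%E & (P B < P A)%E].

Definition same_law (X X' : T -> R) : Prop :=
  forall B : set R, measurable B -> P (X @^-1` B) = P (X' @^-1` B).

(* densities Z = dQ/dP of probability measures Q << P *)
Definition density (Z : T -> R) : Prop :=
  [/\ measurable_fun setT Z, {ae P, forall x, (0 <= Z x)%R}
    & \int[P]_x (Z x)%:E = 1].

(* E_Q X = E_Q X^+ - E_Q X^-, with +oo - +oo = -oo (ereal convention) *)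
Definition EQ (Z X : T -> R) : \bar R :=
  \int[P]_x (Z x * Num.max (X x) 0%R)%:E - \int[P]_x (Z x * Num.max (- X x) 0%R)%:E.

Definition coherent_utility (u : (T -> R) -> \bar R) : Prop :=
  exists D : set (T -> R), [/\ D !=set0, D `<=` density &
    forall X, measurable_fun setT X -> u X = ereal_inf [set EQ Z X | Z in D]].

Definition detset (u : (T -> R) -> \bar R) : set (T -> R) :=
  [set Z | density Z /\ forall X, measurable_fun setT X -> u X <= EQ Z X].

Definition law_invariant_u (u : (T -> R) -> \bar R) : Prop :=
  forall X X', measurable_fun setT X -> measurable_fun setT X' ->
    same_law X X' -> u X = u X'.

Definition law_invariant_set (D : set (T -> R)) : Prop :=
  forall Z Z', D Z -> measurable_fun setT Z' -> same_law Z Z' -> D Z'.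

Definition ulam (l : R) (X : T -> R) : \bar R :=
  ereal_inf [set EQ Z X | Z in
     [set Z | density Z /\ {ae P, forall x, (Z x <= l^-1)%R}]].

(* probability measures on (0,1] are represented as probability measures on R
   concentrated on (0,1] *)
Definition on01 (mu : probability R R) : Prop := mu [set` `]0%R, 1%R]] = 1.

Definition umu (mu : probability R R) (X : T -> R) : \bar R :=
  \int[mu]_(l in [set` `]0%R, 1%R]]) maxe (ulam l X) 0
  - \int[mu]_(l in [set` `]0%R, 1%R]]) maxe (- ulam l X) 0.

End Defs.

(* Main.v *)
Require Import Defs.
From HB Require Import structures.
From mathcomp Require Import all_boot all_order all_algebra.
From mathcomp Require Import all_classical all_reals all_analysis measurable_realfun.
From mathcomp Require Import lra zify.
Import Order.TTheory GRing.Theory Num.Theory.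

(** On an atomless space every X admits, for every Z, a copy Z' of Z with
    the same law that is antimonotone to X, and by the Hardy-Littlewood
    inequality this copy minimises E[ZX] among all pairs with the given
    marginal laws (separately for X^+ and X^-, so that infinite expectations
    cause no trouble).  Hence a law invariant set of densities has a law
    invariant infimum, and conversely the determining set of a law invariant
    utility is law invariant.

    For the mixture representation let mu_Z be the law of l = P(Z > y) when y
    is drawn with density P(Z > y) on (0, oo).  If Z is antimonotone to X then
    the sets {Z > y} carry the lowest values of X, so that
    P(Z > y) u_l(X) = E[X; Z > y] for l = P(Z > y), and integrating over y
    gives u_{mu_Z}(X) = E[ZX].  Therefore Z belongs to the determining set of
    u_{mu_Z}, while u <= u_{mu_Z} as soon as all copies of Z belong to the
    determining set of u: the measures mu_Z, with Z in the determining set,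
    are the ones required by (iii) and (iv). *)

Set Implicit Arguments. Unset Strict Implicit. Unset Printing Implicit Defensive.
Local Open Scope classical_set_scope.
Local Open Scope ring_scope.

(** * Real-valued probabilities of events *)

Section real_probability.
Context {d : measure_display} {T : measurableType d} {R : realType}.
Variable P : probability T R.
Implicit Types A B : set T.

Definition pr A : R := fine (P A).

Lemma prE A : measurable A -> P A = (pr A)%:E.
Proof. by move=> mA; rewrite /pr fineK// fin_num_measure. Qed.

Lemma pr_ge0 A : 0 <= pr A.
Proof. by rewrite /pr fine_ge0. Qed.

Lemma pr_le1 A : measurable A -> pr A <= 1.
Proof. by move=> mA; rewrite -lee_fin -prE// probability_le1. Qed.

Lemma prT : pr setT = 1.
Proof. by rewrite /pr probability_setT. Qed.

Lemma pr0 : pr set0 = 0.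
Proof. by rewrite /pr measure0. Qed.

Lemma pr_le A B : measurable A -> measurable B -> A `<=` B -> pr A <= pr B.
Proof. by move=> mA mB AB; rewrite -lee_fin -!prE// le_measure// inE. Qed.

Lemma prDI A B : measurable A -> measurable B -> pr A = pr (A `\` B) + pr (A `&` B).
Proof.
move=> mA mB; apply: EFin_inj; rewrite EFinD -!prE//.
- exact: measureDI.
- exact: measurableI.
- exact: measurableD.
Qed.

Lemma prC A : measurable A -> pr (~` A) = 1 - pr A.
Proof. by move=> mA; rewrite -prT (prDI measurableT mA) setTD setTI addrK. Qed.

Lemma pr_eq0_le A B : measurable A -> measurable B -> pr (A `\` B) = 0 ->
  pr (A `&` B) = pr A.
Proof. by move=> mA mB AB0; rewrite [RHS](prDI mA mB) AB0 add0r. Qed.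

End real_probability.

(** * A random variable without atoms, built by repeated splitting *)

Section nonatomic_variable.
Context {d : measure_display} {T : measurableType d} {R : realType}.
Variable P : probability T R.
Hypothesis aP : atomless P.
Implicit Types A B F : set T.
Local Notation pr := (pr P).

(** For [B] inside [A] this is positive exactly when both pieces of the split have positive
    probability. *)
Let quality A B : R := Num.min (pr B) (pr (A `\` B)).

(** The qualities are bounded by 1, so their supremum is finite; a near-optimal split attains at
    least half of it, and the empty set serves when the supremum is 0. *)
Let good_split A : measurable A -> exists S, [/\ measurable S, S `<=` A &
  forall B, measurable B -> B `<=` A -> quality A B <= 2 * quality A S].
Proof.
move=> mA; pose E := [set quality A B | B in [set B | measurable B /\ B `<=` A]].
have E0 : E 0.
  by exists set0; [split|rewrite /quality pr0 min_l ?pr_ge0].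
have hE : has_sup E.
  split; first by exists 0.
  exists 1 => _ [B [mB _] <-]; rewrite /quality ge_min; apply/orP; left.
  exact: pr_le1.
have supE0 : 0 <= sup E by exact: sup_upper_bound.
have leE B : measurable B -> B `<=` A -> quality A B <= sup E.
  by move=> mB BA; apply: sup_upper_bound => //; exists B.
have [s0|s0] := leP (sup E) 0.
  exists set0; split => // B mB BA.
  rewrite (le_trans (leE _ mB BA))// (le_trans s0)// mulr_ge0//.
  by rewrite /quality le_min !pr_ge0.
have [_ [S [mS SA] <-] lS] := @sup_adherent _ E (sup E / 2) ltac:(lra) hE.
exists S; split => // B mB BA; apply: (le_trans (leE _ mB BA)).
lra.
Qed.

Let splitter : {S : set T -> set T & forall A, measurable A ->
  [/\ measurable (S A), S A `<=` A &
  forall B, measurable B -> B `<=` A -> quality A B <= 2 * quality A (S A)]}.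
Proof.
apply: (@choice _ _ (fun A S => measurable A -> [/\ measurable S, S `<=` A &
  forall B, measurable B -> B `<=` A -> quality A B <= 2 * quality A S])) => A.
have [mA|nA] := pselect (measurable A); last by exists set0.
by have [S HS] := good_split mA; exists S.
Qed.

Let S := projT1 splitter.

Let S_P A : measurable A -> [/\ measurable (S A), S A `<=` A &
  forall B, measurable B -> B `<=` A -> quality A B <= 2 * quality A (S A)].
Proof. exact: (projT2 splitter). Qed.

(* [N n w] is the integer part of [4 ^+ n * V w] for the variable [V] below, so
   a fibre of [V] meets a single cell of each generation; base 2 would not
   exclude ambiguous expansions. *)
Let N := fix N (n : nat) : T -> nat :=
  if n is n'.+1 then
    fun w => (4 * N n' w + `[< S (N n' @^-1` [set N n' w]) w >])%N
  else fun=> 0%N.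

Let NS n w : N n.+1 w = (4 * N n w + `[< S (N n @^-1` [set N n w]) w >])%N.
Proof. by []. Qed.

Let mN n k : measurable (N n @^-1` [set k]).
Proof.
elim: n k => [|n IH] k.
  have -> : N 0 @^-1` [set k] = if k == 0%N then setT else set0.
    apply/seteqP; split => w /=; first by move=> <-.
    by case: eqP.
  by case: ifP.
have -> : N n.+1 @^-1` [set k] = \bigcup_j (N n @^-1` [set j] `&`
    ((if k == (4 * j + 1)%N then S (N n @^-1` [set j]) else set0) `|`
     (if k == (4 * j)%N then ~` S (N n @^-1` [set j]) else set0))).
  apply/seteqP; split => w.
    rewrite /preimage/= => <-; exists (N n w) => //; split => //.
    case: asboolP => Sw; [left|right].
      by rewrite eqxx.
    by rewrite addn0 eqxx.
  move=> [j _ [/= Nj]]; rewrite /preimage/= -Nj => -[].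
    by case: eqP => // -> Sw; rewrite asboolT.
  by case: eqP => // -> Sw; rewrite asboolF// addn0.
apply: bigcup_measurable => j _; have [mS _ _] := S_P (IH j).
apply: measurableI => //; apply: measurableU; case: ifP => // _.
exact: measurableC.
Qed.

(* On a set of positive measure a nontrivial split persists along the nested
   cells containing it, so every cell loses a fixed amount at each step. *)
Let cell_null F : measurable F ->
  (forall n w w', F w -> F w' -> N n w = N n w') -> pr F = 0.
Proof.
move=> mF FN; apply/eqP; rewrite eq_le pr_ge0 andbT leNgt; apply/negP => F0.
have [|B [mB BF B0 BltF]] := aP mF; first by rewrite prE// lte_fin.
rewrite prE// lte_fin in B0; rewrite !prE// lte_fin in BltF.
have [w Fw] : F !=set0.
  by apply/set0P; apply/eqP => F_0; rewrite F_0 pr0 ltxx in F0.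
have Bw : pr (F `\` B) = pr F - pr B.
  by rewrite (prDI P mF mB) setIidr// addrK.
pose e := quality F B.
have e0 : 0 < e by rewrite /e /quality lt_min B0 Bw subr_gt0.
pose A n := N n @^-1` [set N n w].
have mA n : measurable (A n) by exact: mN.
have FA n : F `<=` A n by move=> w' Fw'; exact: FN.
have step n : pr (A n.+1) <= pr (A n) - e / 2.
  have [mS SA /(_ B mB (subset_trans BF (FA n))) qS] := S_P (mA n).
  (* [A n] contains [F], so [B] splits it at least as well as it splits [F]. *)
  have eq : e <= quality (A n) B.
    rewrite /e /quality le_min !ge_min lexx/=; apply/orP; right.
    apply: pr_le; [exact: measurableD|exact: measurableD|].
    by move=> x [Fx nBx]; split => //; exact: FA.
  have lS : quality (A n) (S (A n)) <= pr (S (A n)) by rewrite ge_min lexx.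
  have lD : quality (A n) (S (A n)) <= pr (A n `\` S (A n)) by rewrite ge_min lexx orbT.
  have D := prDI P (mA n) mS; rewrite setIidr// in D.
  (* The new cell lies on the side of the split that contains [w]; the other side, which is lost,
     has probability at least [e / 2]. *)
  have : pr (A n.+1) <= pr (A n `\` S (A n)) \/ pr (A n.+1) <= pr (S (A n)).
    have [Sw|nSw] := pselect (S (A n) w); [right|left]; apply: pr_le => //;
        try exact: measurableD.
      move=> w'; rewrite /A/= /preimage/= -/(A n) (asboolT Sw).
      have -> : S (A n) = S (N n @^-1` [set N n w]) by [].
      case: asboolP => /= Sw' eqN; last by exfalso; lia.
      by have <- : N n w' = N n w by lia.
    move=> w'; rewrite /A/= /preimage/= -/(A n) (asboolF nSw).
    case: asboolP => /= Sw' eqN; first by exfalso; lia.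
    have eqN' : N n w' = N n w by lia.
    by split => //; move: Sw'; rewrite eqN'.
  move=> [] h; lra.
have bound n : pr (A n) <= 1 - n%:R * (e / 2).
  elim: n => [|n IH]; first by rewrite mul0r subr0 pr_le1.
  apply: (le_trans (step n)); rewrite -[n.+1%:R]natr1; lra.
(* After more than [2 / e] generations the bound is negative. *)
have := bound (Num.bound (2 / e)).
have := pr_ge0 P (A (Num.bound (2 / e))).
have : 2 / e < (Num.bound (2 / e))%:R.
  by apply: archi_boundP; rewrite divr_ge0// ltW.
rewrite ltr_pdivrMr//; nra.
Qed.

(** The number with the base-4 digits 0 or 1 chosen along the cells of [w], cut after [n] places. *)
Let h n w : R := (N n w)%:R / 4 ^+ n.

Let V w : R := sup (range (h^~ w)).

Let h_le n m w : (n <= m)%N -> h n w <= h m w.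
Proof.
move=> /subnK <-; elim: (m - n)%N => [|k IH]; first by rewrite add0n.
apply: (le_trans IH); rewrite addSn /h NS exprS invfM natrD natrM.
rewrite mulrA mulrDl mulrAC divff// mul1r ler_wpM2r//.
by rewrite lerDl divr_ge0.
Qed.

(** All digits are at most 1, so digits [n + 1] to [m] add at most a geometric sum of ratio 1/4. *)
Let h_ge n m w : (n <= m)%N -> h m w <= h n w + (1 - 4 ^- (m - n)) / 3 / 4 ^+ n.
Proof.
move=> /subnK <-; rewrite addnK; elim: (m - n)%N => [|k IH].
  by rewrite add0n expr0 invr1 subrr !mul0r addr0.
rewrite addSn /h NS natrD natrM [4 ^+ (k + n).+1]exprS invfM.
have b1 : ((`[< S (N (k + n) @^-1` [set N (k + n) w]) w >] : nat)%:R : R) <= 1.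
  by case: asboolP => _; rewrite ?lexx// ler01.
set b := _%:R in b1 *; rewrite mulrA mulrDl mulrAC divff// mul1r mulrDl.
have -> : (N (k + n) w)%:R / 4 ^+ (k + n) = h (k + n) w by [].
rewrite exprS invfM; move: IH; rewrite -/(h n w).
have -> : (4 : R) ^- (k + n) = 4 ^- k * 4 ^- n by rewrite exprD invfM.
have x0 : 0 <= 4 ^- k * 4 ^- n :> R by rewrite mulr_ge0// invr_ge0 exprn_ge0.
move: (4 ^- k) x0 => x; move: (4 ^- n) => y x0.
nra.
Qed.

Let hub w n : h n w <= 1 / 3.
Proof.
have := @h_ge 0%N n w (leq0n _); rewrite subn0 expr0 /h/= mul0r add0r invr1 mulr1.
have : 0 <= 4 ^- n :> R by rewrite invr_ge0 exprn_ge0.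
lra.
Qed.

Let hsup w : has_sup (range (h^~ w)).
Proof. by split; [exists (h 0%N w); exists 0%N|exists (1 / 3) => _ [n _ <-]]. Qed.

Let V_ge n w : h n w <= V w.
Proof. by apply: sup_upper_bound => //; exists n. Qed.

(** The tail of the expansion is at most a third of [4 ^- n]; the strict inequality is what makes
    [N n w] the integer part of [4 ^+ n * V w]. *)
Let V_lt n w : V w < h n w + 4 ^- n.
Proof.
have p0 : 0 < 4 ^- n :> R by rewrite invr_gt0 exprn_gt0.
apply: (@le_lt_trans _ _ (h n w + 4 ^- n / 3)); last lra.
apply: ge_sup; first by exists (h 0%N w); exists 0%N.
move=> _ [m _ <-]; have [nm|/ltnW mn] := leqP n m; last first.
  by apply: (le_trans (h_le _ mn)); lra.
apply: (le_trans (h_ge _ nm)).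
have : 0 <= 4 ^- (m - n) :> R by rewrite invr_ge0 exprn_ge0.
nra.
Qed.

Let V_inj n w w' : V w = V w' -> N n w = N n w'.
Proof.
have p0 : 0 < 4 ^- n :> R by rewrite invr_gt0 exprn_gt0.
move=> eV; have := V_ge n w; have := V_lt n w; rewrite eV => a1 a2.
have a3 := V_ge n w'; have a4 := V_lt n w'.
have : h n w < h n w' + 4 ^- n by exact: le_lt_trans a2 a4.
have : h n w' < h n w + 4 ^- n by exact: le_lt_trans a3 a1.
have cmp (a b : nat) : a%:R / 4 ^+ n < b%:R / 4 ^+ n + 4 ^- n :> R -> (a < b.+1)%N.
  by rewrite -[X in _ + X]mul1r -mulrDl ltr_pM2r// natr1 ltr_nat.
by move=> /cmp b1 /cmp b2; lia.
Qed.

Let mV : measurable_fun setT V.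
Proof.
have -> : V = (fun w => sups (h^~ w) 0%N).
  apply/funext => w; rewrite /V /sups /sdrop; congr sup.
  by apply/seteqP; split => _ [n _ <-]; exists n.
apply: measurable_fun_sups => [w _|n].
  by exists (1 / 3) => _ [n _ <-]; exact: hub.
move=> _ Y mY; rewrite setTI.
have -> : h n @^-1` Y = \bigcup_(k in [set k : nat | Y (k%:R / 4 ^+ n)]) (N n @^-1` [set k]).
  apply/seteqP; split => w /=; first by move=> Yw; exists (N n w).
  by move=> [k /= Yk]; rewrite /preimage/= => Nk; rewrite /preimage/= /h Nk.
by apply: bigcup_measurable => k _; exact: mN.
Qed.

(** Points of one fibre of [V] share their cell in every generation, and such sets are null by
    [cell_null]. *)
Lemma atomless_nonatomic_variable : exists V : T -> R,
  [/\ measurable_fun setT V, (forall w, 0 <= V w <= 1) &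
      forall v, pr (V @^-1` [set v]) = 0].
Proof.
exists V; split => // [w|v].
  have := V_ge 0 w; have := V_lt 0 w; rewrite /h/= mul0r expr0 invr1 add0r.
  by move=> /ltW -> ->.
apply: cell_null.
  by rewrite -[X in measurable X]setTI; exact: mV.
by move=> n w w' /= <- e; apply: V_inj.
Qed.

End nonatomic_variable.

(** * Measurability of comparison sets *)

Section level_sets.
Context {d : measure_display} {T : measurableType d} {R : realType}.
Implicit Types f g : T -> R.

Lemma measurable_lt_set f g : measurable_fun setT f -> measurable_fun setT g ->
  measurable [set w | f w < g w].
Proof.
move=> mf mg; have := measurable_fun_ltr mf mg => /(_ measurableT [set true]).
by rewrite setTI; apply.
Qed.

Lemma measurable_le_set f g : measurable_fun setT f -> measurable_fun setT g ->
  measurable [set w | f w <= g w].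
Proof.
move=> mf mg; have := measurable_fun_ler mf mg => /(_ measurableT [set true]).
by rewrite setTI; apply.
Qed.

Lemma measurable_eq_set f g : measurable_fun setT f -> measurable_fun setT g ->
  measurable [set w | f w = g w].
Proof.
move=> mf mg; have := measurable_fun_eqr mf mg => /(_ measurableT [set true]).
rewrite setTI (_ : _ @^-1` _ = [set w | f w = g w]); first by apply.
by apply/seteqP; split => w /=; rewrite /preimage/= => /eqP.
Qed.

End level_sets.

(** * Quantiles, from continuity of probability along monotone sequences *)

Section quantile.
Context {d : measure_display} {T : measurableType d} {R : realType}.
Variable P : probability T R.
Local Notation pr := (pr P).

Lemma pr_bigcup_le (F : (set T)^nat) (t : R) : (forall n, measurable (F n)) ->
  nondecreasing_seq F -> (forall n, pr (F n) <= t) -> pr (\bigcup_n F n) <= t.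
Proof.
move=> mF ndF Ft; have mU : measurable (\bigcup_n F n) by exact: bigcup_measurable.
have cv := nondecreasing_cvg_mu (mu := P) mF mU ndF.
rewrite -lee_fin -prE// -(cvg_lim _ cv)//; apply: lime_le.
  by apply/cvg_ex; eexists; exact: cv.
by apply: nearW => n /=; rewrite prE// lee_fin.
Qed.

Lemma pr_bigcap_ge (F : (set T)^nat) (t : R) : (forall n, measurable (F n)) ->
  nonincreasing_seq F -> (forall n, t <= pr (F n)) -> t <= pr (\bigcap_n F n).
Proof.
move=> mF niF Ft; have mI : measurable (\bigcap_n F n) by exact: bigcap_measurable.
have F0 : (P (F 0%N) < +oo)%E by rewrite prE// ltry.
have cv := nonincreasing_cvg_mu (mu := P) F0 mF mI niF.
rewrite -lee_fin -prE// -(cvg_lim _ cv)//; apply: lime_ge.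
  by apply/cvg_ex; eexists; exact: cv.
by apply: nearW => n /=; rewrite prE// lee_fin.
Qed.

Lemma invS_le (n m : nat) : (n <= m)%N -> m.+1%:R^-1 <= n.+1%:R^-1 :> R.
Proof. by move=> nm; rewrite lef_pV2 ?posrE// ler_nat. Qed.

(** [c] is the infimum of the points where the distribution function of [Y] on [B] reaches [t]. The
    bounds on [t] make this set nonempty and bounded below; approaching [c] from the left and from
    the right gives the two inequalities. *)
Lemma exists_quantile (Y : T -> R) (B : set T) (t : R) : measurable_fun setT Y ->
  measurable B -> 0 < t < pr B -> exists c : R,
  pr (B `&` [set w | Y w < c]) <= t <= pr (B `&` [set w | Y w <= c]).
Proof.
move=> mY mB /andP[t0 tB].
have mle c : measurable (B `&` [set w | Y w <= c]).
  by apply: measurableI => //; exact: measurable_le_set.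
pose E := [set x | t <= pr (B `&` [set w | Y w <= x])].
have E0 : E !=set0.
  apply: contrapT => nE; have: pr B <= t; last by rewrite leNgt tB.
  have -> : B = \bigcup_n (B `&` [set w | Y w <= n%:R]).
    rewrite -setI_bigcupr; apply/esym/setIidl => w _.
    by exists (Num.truncn (Y w)).+1 => //=; rewrite ltW// truncnS_gt.
  apply: pr_bigcup_le => // [m n mn|n].
    apply/subsetPset; apply: setIS => w /= /le_trans; apply; by rewrite ler_nat.
  by rewrite leNgt; apply/negP => /ltW h; apply: nE; exists n%:R.
have lE : has_lbound E.
  apply: contrapT => nE; have: t <= 0; last by rewrite leNgt t0.
  rewrite -(pr0 P).
  have -> : set0 = \bigcap_n (B `&` [set w | Y w <= - n%:R]) :> set T.
    apply/esym; rewrite -subset0 => w /(_ (Num.truncn (- Y w)).+1 I) [_ /=].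
    by rewrite leNgt => /negP; apply; rewrite ltrNl truncnS_gt.
  apply: pr_bigcap_ge => // [m n mn|n].
    apply/subsetPset; apply: setIS => w /= /le_trans; apply; by rewrite lerN2 ler_nat.
  rewrite leNgt; apply/negP => h; apply: nE; exists (- n%:R) => x Ex.
  rewrite leNgt; apply/negP => xn; have := le_lt_trans Ex (le_lt_trans _ h).
  rewrite ltxx => /(_ _)/notF; apply.
  apply: pr_le => //; apply: setIS => w /= /le_trans; apply; exact: ltW.
have hE : has_inf E by [].
exists (inf E); apply/andP; split.
  have -> : [set w | Y w < inf E] = \bigcup_n [set w | Y w <= inf E - n.+1%:R^-1].
    apply/seteqP; split => w /=.
      by move=> /ltr_add_invr[k hk]; exists k => //=; rewrite lerBrDr ltW.
    move=> [n _ /= h]; apply: (le_lt_trans h); by rewrite ltrBlDr ltrDl.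
  rewrite setI_bigcupr; apply: pr_bigcup_le => // [m n mn|n].
    by apply/subsetPset; apply: setIS => w /= /le_trans; apply; rewrite lerB// invS_le.
  rewrite leNgt; apply/negP => /ltW h.
  have : inf E <= inf E - n.+1%:R^-1 by exact: ge_inf.
  by rewrite leNgt ltrBlDr ltrDl invr_gt0 ltr0n.
have -> : [set w | Y w <= inf E] = \bigcap_n [set w | Y w <= inf E + n.+1%:R^-1].
  apply/seteqP; split => w /= h.
    by move=> n _ /=; rewrite (le_trans h)// lerDl.
  rewrite leNgt; apply/negP => /ltr_add_invr[k hk].
  by have := h k I => /=; rewrite leNgt hk.
rewrite -bigcapIr; last by exists 0%N.
apply: pr_bigcap_ge => // [m n mn|n].
  by apply/subsetPset; apply: setIS => w /= /le_trans; apply; rewrite lerD2l invS_le.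
have [|e Ee el] := @inf_adherent _ E n.+1%:R^-1 _ hE; first by rewrite invr_gt0.
apply: (le_trans Ee); apply: pr_le => //; apply: setIS => w /= /le_trans; apply.
exact: ltW.
Qed.

End quantile.

(** * A uniform variable ordered like a given variable *)

Section uniform_variable.
Context {d : measure_display} {T : measurableType d} {R : realType}.
Variable P : probability T R.
Hypothesis aP : atomless P.
Local Notation pr := (pr P).

(** This is the distributional transform, with ties of [X] broken by a nonatomic [V]: [U w] is the
    probability of the lexicographic lower set generated by [(X w, V w)]. *)
Lemma atomless_uniform_variable (X : T -> R) : measurable_fun setT X ->
  exists U : T -> R, [/\ measurable_fun setT U,
    (forall t : R, 0 <= t <= 1 -> pr [set w | U w < t] = t) &
    forall w w', U w < U w' -> X w <= X w'].
Proof.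
move=> mX; have [V [mV V01 V0]] := atomless_nonatomic_variable aP.
pose L c v := [set w | X w < c] `|` ([set w | X w = c] `&` [set w | V w <= v]).
have mXl c : measurable [set w | X w < c] by exact: measurable_lt_set.
have mXe c : measurable [set w | X w = c] by exact: measurable_eq_set.
have mVl v : measurable [set w | V w <= v] by exact: measurable_le_set.
have mL c v : measurable (L c v) by apply: measurableU => //; exact: measurableI.
have prL c v : pr (L c v) = pr [set w | X w < c] + pr ([set w | X w = c] `&` [set w | V w <= v]).
  rewrite (prDI P (mL c v) (mXl c)) addrC; congr (pr _ + pr _).
    by apply/seteqP; split => w [] //; split => //; left.
  apply/seteqP; split => w [] /=; first by case.
  by move=> Xc Vv; split; [right|rewrite Xc ltxx].
(* [L c v] is a lower set of the lexicographic order of the pair (X, V). *)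
pose U w := pr (L (X w) (V w)).
have mU : measurable_fun setT U.
  pose A := [set ww : T * T | X ww.2 < X ww.1] `|`
    ([set ww : T * T | X ww.2 = X ww.1] `&` [set ww : T * T | V ww.2 <= V ww.1]).
  have mA : measurable A.
    have m2 (f : T -> R) : measurable_fun setT f ->
        measurable_fun setT (fun ww : T * T => f ww.2).
      by move=> mf; apply: (measurableT_comp mf); exact: measurable_snd.
    have m1 (f : T -> R) : measurable_fun setT f ->
        measurable_fun setT (fun ww : T * T => f ww.1).
      by move=> mf; apply: (measurableT_comp mf); exact: measurable_fst.
    apply: measurableU; last apply: measurableI.
    - by apply: measurable_lt_set; [exact: m2|exact: m1].
    - by apply: measurable_eq_set; [exact: m2|exact: m1].
    - by apply: measurable_le_set; [exact: m2|exact: m1].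
  have -> : U = fine \o (P \o xsection A).
    apply/funext => w; rewrite /U /pr/=; congr (fine (P _)).
    by apply/seteqP; split => w'; rewrite xsectionP.
  apply: measurableT_comp; first exact: fine_measurable.
  exact: measurable_fun_xsection.
(* With [supL] this expresses that lexicographic lower sets are nested. *)
have Lsub w c v : L c v w -> L (X w) (V w) `<=` L c v.
  move=> Lw w' Lw'; case: Lw => [/= Xw|[/= Xw Vw]]; case: Lw' => [/= Xw'|[/= Xw' Vw']].
  - by left => /=; exact: lt_trans Xw.
  - by left => /=; rewrite Xw'.
  - by left => /=; rewrite -Xw.
  - by right; split => /=; [rewrite Xw'|exact: le_trans Vw].
have supL w c v : ~ L c v w -> L c v `<=` L (X w) (V w).
  move=> nL w' Lw'; have [h|h|h] := ltgtP (X w) c.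
  - by exfalso; apply: nL; left.
  - by case: Lw' => [/= h'|[/= h' _]]; left => /=; [exact: lt_trans h|rewrite h'].
  - case: Lw' => [/= h'|[/= h' Vw']]; first by left => /=; rewrite h.
    right; split => /=; first by rewrite h h'.
    have [//|/ltW vw] := leP (V w') (V w).
    by exfalso; apply: nL; right; split => //=; exact: le_trans Vw'.
(* Lower sets of probability exactly [t] pin down the law of [U], which is at most [t] on such a set
   and at least [t] off it. *)
have exL (t : R) : 0 < t < 1 -> exists A, [/\ measurable A, pr A = t,
    A `<=` [set w | U w <= t] & ~` A `<=` [set w | t <= U w]].
  move=> t01; suff [c [v Lt]] : exists c v, pr (L c v) = t.
    exists (L c v); split => // w /= Lw; rewrite -[t in X in is_true X]Lt.
      by apply: pr_le => //; exact: Lsub.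
    by apply: pr_le => //; exact: supL.
  have [|c] := @exists_quantile _ _ _ P X setT t mX measurableT; first by rewrite prT.
  rewrite !setTI => /andP[cl cu].
  have : pr [set w | X w <= c] = pr [set w | X w < c] + pr [set w | X w = c].
    rewrite (@prDI _ _ _ P [set w | X w <= c] [set w | X w < c])//; last exact: measurable_le_set.
    rewrite addrC; congr (pr _ + pr _); apply/seteqP; split => w /=.
    - by case.
    - by move=> h; split => //; exact: ltW.
    - by move=> [h1 /negP]; rewrite -leNgt => h2; apply/eqP; rewrite eq_le h1 h2.
    - by move=> ->; rewrite lexx ltxx.
  move=> eq; rewrite eq in cu.
  move: cl; rewrite le_eqVlt => /orP[/eqP cl|cl].
    (* As [V] takes values between 0 and 1, [v = -1] takes no tie and [v = 1] takes all of them. *)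
    exists c, (-1); rewrite prL (_ : _ `&` _ = set0) ?pr0 ?addr0//.
    rewrite -subset0 => w [_ /=]; have /andP[Vw _] := V01 w; lra.
  move: cu; rewrite le_eqVlt => /orP[/eqP cu|cu].
    exists c, 1; rewrite prL (_ : _ `&` _ = [set w | X w = c])//.
    by apply/setIidl => w _ /=; have /andP[] := V01 w.
  (* Strictly in between, [v] is a quantile of [V] on the tie set; the fibre of [V] at [v] is null,
     so both quantile bounds agree. *)
  have [|v /andP[v1 v2]] := @exists_quantile _ _ _ P V [set w | X w = c]
    (t - pr [set w | X w < c]) mV (mXe c).
    by rewrite subr_gt0 cl ltrBlDl.
  exists c, v; rewrite prL; apply/eqP; rewrite eq_le; apply/andP; split; last lra.
  rewrite -lerBrDl; apply: (le_trans _ v1).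
  have mVlt : measurable [set w | V w < v] by exact: measurable_lt_set.
  rewrite (@prDI _ _ _ P (_ `&` _) [set w | V w < v])//; last exact: measurableI.
  have : pr (([set w | X w = c] `&` [set w | V w <= v]) `\` [set w | V w < v]) <= 0.
    rewrite -(V0 v); apply: pr_le.
    - by apply: measurableD => //; exact: measurableI.
    - by rewrite -[X in measurable X]setTI; exact: mV.
    - move=> w [[_ /= h1] /= /negP]; rewrite -leNgt => h2.
      by apply/eqP; rewrite eq_le h1 h2.
  have : pr (([set w | X w = c] `&` [set w | V w <= v]) `&` [set w | V w < v]) <=
    pr ([set w | X w = c] `&` [set w | V w < v]).
    apply: pr_le; [apply: measurableI => //; exact: measurableI|exact: measurableI|].
    by move=> w [[]].
  lra.
have mUl t : measurable [set w | U w < t] by exact: measurable_lt_set.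
have mUle t : measurable [set w | U w <= t] by exact: measurable_le_set.
have U_le (t : R) : 0 < t < 1 -> pr [set w | U w < t] <= t.
  move=> /exL[A [mA At _ nA]]; rewrite -[leRHS]At; apply: pr_le => // w /= h.
  by apply: contrapT => /nA /=; rewrite leNgt h.
have U_ge (s t : R) : 0 < s < 1 -> s < t -> s <= pr [set w | U w < t].
  move=> /exL[A [mA At AU _]] st; rewrite -[leLHS]At; apply: pr_le => // w /AU /= h.
  exact: le_lt_trans st.
(* [U_ge] only reaches [s] below [t]; applied to the midpoint of the probability and [t] it refutes
   a strict inequality. *)
have U_ge' (t : R) : 0 < t <= 1 -> t <= pr [set w | U w < t].
  move=> /andP[t0 t1]; rewrite leNgt; apply/negP => h.
  have := pr_ge0 P [set w | U w < t]; set p := pr _ in h * => p0.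
  have := @U_ge ((p + t) / 2) t; rewrite -/p.
  have -> : 0 < (p + t) / 2 < 1 by apply/andP; split; lra.
  move=> /(_ isT) hh; have : (p + t) / 2 <= p by apply: hh; lra.
  lra.
exists U; split => // [t /andP[t0 t1]|w w' UU].
  move: t0; rewrite le_eqVlt => /orP[/eqP <-|t0].
    rewrite (_ : [set _ | _] = set0) ?pr0//.
    by rewrite -subset0 => w /=; rewrite ltNge pr_ge0.
  apply/eqP; rewrite eq_le U_ge' ?t0// andbT.
  have [t1'|t1'] := ltP t 1; first by rewrite U_le ?t0.
  by rewrite (le_trans _ t1')// pr_le1.
rewrite leNgt; apply/negP => XX; move: UU; rewrite ltNge => /negP; apply.
apply: pr_le => // w'' [/= h|[/= h _]]; left => /=; first exact: lt_trans XX.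
by rewrite h.
Qed.

End uniform_variable.

(** * Determination of a law by its tails *)

Section same_law_tails.
Context {d : measure_display} {T : measurableType d} {R : realType}.
Variable P : probability T R.
Local Notation pr := (pr P).
Implicit Types X Y Z : T -> R.

Lemma measurable_preimageT X B : measurable_fun setT X -> measurable B ->
  measurable (X @^-1` B).
Proof. by move=> mX mB; rewrite -[X in measurable X]setTI; exact: mX. Qed.

Lemma same_law_sym X Y : same_law P X Y -> same_law P Y X.
Proof. by move=> XY B mB; rewrite XY. Qed.

Lemma same_law_pr X Y B : same_law P X Y -> measurable B ->
  pr (X @^-1` B) = pr (Y @^-1` B).
Proof. by move=> XY mB; rewrite /pr XY. Qed.


(** The half-lines []z, +oo[] are closed under intersection and generate the Borel sets, so finite
    measures that agree on them are equal. *)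
Lemma same_law_tails X Y : measurable_fun setT X -> measurable_fun setT Y ->
  (forall z, pr [set w | z < X w] = pr [set w | z < Y w]) -> same_law P X Y.
Proof.
move=> mX mY XY B mB.
pose mX' := isMeasurableFun.Build _ _ _ _ _ mX.
pose mY' := isMeasurableFun.Build _ _ _ _ _ mY.
pose Xm : {mfun T >-> R} := HB.pack X mX'.
pose Ym : {mfun T >-> R} := HB.pack Y mY'.
have tail (Z : T -> R) z : Z @^-1` `]z, +oo[ = [set w | z < Z w].
  by apply/seteqP; split => w /=; rewrite /preimage/= in_itv/= andbT.
have pf (Z : T -> R) z : measurable_fun setT Z ->
    P (Z @^-1` `]z, +oo[) = (pr [set w | z < Z w])%:E.
  by move=> mZ; rewrite tail prE//; exact: measurable_lt_set.
apply: (@measure_unique _ R _ (@RGenOInfty.G R) (fun n => `](- n%:R)%R, +oo[%classic)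
  _ _ _ _ (pushforward P Xm) (pushforward P Ym)) => //.
- exact: RGenOInfty.measurableE.
- move=> _ _ [x ->] [y ->]; exists (Num.max x y).
  apply/seteqP; split => z /=; rewrite !in_itv/= !andbT gt_max.
    by move=> [-> ->].
  by move=> /andP.
- by move=> n; exists (- n%:R).
- apply/seteqP; split => // z _; exists (Num.truncn (- z)).+1 => //=.
  by rewrite in_itv/= andbT ltrNl truncnS_gt.
- move=> _ [x ->].
  exact: (etrans (pf X x mX) (etrans (congr1 EFin (XY x)) (esym (pf Y x mY)))).
- move=> n.
  exact: (eq_ind_r (fun x => (x < +oo)%E) (ltry _) (pf X (- n%:R) mX)).
Qed.

End same_law_tails.

(** * Antimonotone rearrangement *)

Section rearrangement.
Context {d : measure_display} {T : measurableType d} {R : realType}.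
Variable P : probability T R.
Local Notation pr := (pr P).
Implicit Types X Y Z : T -> R.

(** Only strict inequalities of [X] constrain [Z]; ties are free, which makes the relation
    symmetric. *)
Definition antimonotone X Z := exists N : set T, [/\ measurable N, pr N = 0 &
  forall w w', ~ N w -> ~ N w' -> X w < X w' -> Z w' <= Z w].

Lemma antimonotone_sym X Z : antimonotone X Z -> antimonotone Z X.
Proof.
move=> [N [mN N0 XZ]]; exists N; split => // w w' Nw Nw' ZZ.
by rewrite leNgt; apply/negP => XX; have := XZ _ _ Nw Nw' XX; rewrite leNgt ZZ.
Qed.

(** [Z'] is the upper quantile function of [Z] taken at [U]: the infimum of the [z] with
    [P(Z > z) <= U]. It decreases in [U], which is ordered like [X], and it has the tails of [Z]
    because [U] is uniform. *)
Lemma exists_antimonotone X Z : atomless P -> measurable_fun setT X ->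
  measurable_fun setT Z -> exists Z', [/\ measurable_fun setT Z',
    same_law P Z Z' & antimonotone X Z'].
Proof.
move=> aP mX mZ; have [U [mU Ulaw UX]] := atomless_uniform_variable aP mX.
pose g z := pr [set w | z < Z w].
have mZg z : measurable [set w | z < Z w] by exact: measurable_lt_set.
have mUl t : measurable [set w | U w < t] by exact: measurable_lt_set.
have g01 z : 0 <= g z <= 1 by rewrite pr_ge0 pr_le1.
pose G := [set w | 0 < U w] `&` [set w | U w < 1].
have mG : measurable G by apply: measurableI => //; exact: measurable_lt_set.
(* The event [U >= 1] is null by uniformity, and [U <= 0] lies in [U < e'], of probability [e']. *)
have G1 : pr (~` G) = 0.
  apply/eqP; rewrite eq_le pr_ge0 andbT; apply/ler_addgt0Pr => e e0; rewrite add0r.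
  pose e' := Num.min e 1.
  have e'01 : 0 < e' <= 1 by rewrite lt_min e0 ge_min lexx orbT ltr01.
  have [e'0 e'1] := andP e'01.
  apply: (@le_trans _ _ e'); last by rewrite ge_min lexx.
  have mc : measurable (~` [set w | U w < 1]) by exact: measurableC.
  rewrite (prDI P (measurableC mG) mc).
  have : pr (~` G `&` ~` [set w | U w < 1]) <= 0.
    have <- : pr (~` [set w | U w < 1]) = 0 by rewrite prC// Ulaw ?lexx ?ler01// subrr.
    by apply: pr_le => //; exact: measurableI (measurableC mG) mc.
  have : pr (~` G `\` ~` [set w | U w < 1]) <= e'.
    rewrite -[leRHS]Ulaw; last by rewrite e'1 ltW.
    apply: pr_le => //; first exact: measurableD (measurableC mG) mc.
    move=> w [nG /contrapT U1] /=; rewrite ltNge; apply/negP => Ue; apply: nG.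
    by split => //=; exact: lt_le_trans Ue.
  lra.
pose E w := [set z | g z <= U w].
(* The value 0 is a default on the null set outside [G], where [E w] might be empty or unbounded
   below. *)
pose Z' w := if `[< G w >] then inf (E w) else 0.
(* A Galois connection between quantile and tail: [g] is right continuous, so the infimum belongs to
   [E w]. *)
have Z'P w (z : R) : G w -> (Z' w <= z) = (g z <= U w).
  move=> Gw; rewrite /Z' asboolT//; have [/= U0 U1] := Gw.
  have E0 : E w !=set0.
    apply: contrapT => nE; have : U w <= 0; last by rewrite leNgt U0.
    rewrite -(pr0 P).
    have -> : set0 = \bigcap_n [set w | n%:R < Z w] :> set T.
      apply/esym; rewrite -subset0 => v /(_ (Num.truncn (Z v)).+1 I) /=.
      by rewrite ltNge => /negP; apply; rewrite ltW// truncnS_gt.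
    apply: pr_bigcap_ge => // [m n mn|n].
      by apply/subsetPset => v /=; apply: le_lt_trans; rewrite ler_nat.
    by rewrite leNgt; apply/negP => /ltW h; apply: nE; exists n%:R.
  have lE : has_lbound (E w).
    apply: contrapT => nE; have : 1 <= U w; last by rewrite leNgt U1.
    rewrite -(prT P).
    have -> : setT = \bigcup_n [set v | - n%:R < Z v].
      apply/seteqP; split => // v _; exists (Num.truncn (- Z v)).+1 => //=.
      by rewrite ltrNl truncnS_gt.
    apply: pr_bigcup_le => // [m n mn|n].
      by apply/subsetPset => v /=; apply: le_lt_trans; rewrite lerN2 ler_nat.
    rewrite leNgt; apply/negP => h; apply: nE; exists (- n%:R) => x Ex.
    rewrite leNgt; apply/negP => xn; have : U w < U w; last by rewrite ltxx.
    apply: (lt_le_trans h); apply: le_trans Ex; apply: pr_le => // v /=.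
    exact: lt_trans.
  apply/idP/idP => h; last by apply: ge_inf.
  apply: (@le_trans _ _ (g (inf (E w)))).
    by apply: pr_le => // v /=; exact: le_lt_trans.
  rewrite /g (_ : [set _ | _] = \bigcup_n [set v | inf (E w) + n.+1%:R^-1 < Z v]).
    apply: pr_bigcup_le => // [m n mn|n].
      apply/subsetPset => v /=; apply: le_lt_trans; by rewrite lerD2l invS_le.
    have [||e Ee el] := @inf_adherent _ (E w) n.+1%:R^-1; rewrite ?invr_gt0//.
    apply: le_trans Ee; apply: pr_le => // v /=; apply: le_lt_trans; exact: ltW.
  apply/seteqP; split => v /=.
    by move=> /ltr_add_invr[k hk]; exists k.
  by move=> [n _ /=]; apply: le_lt_trans; rewrite lerDl.
have tailZ' (z : R) : [set w | z < Z' w] =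
    (G `&` [set w | U w < g z]) `|` (~` G `&` [set w | z < 0]).
  apply/seteqP; split => w /=.
    have [Gw|nGw] := pselect (G w); first by rewrite !ltNge Z'P//; left.
    by rewrite /Z' asboolF//; right.
  move=> [[Gw]|[nGw]]; first by rewrite !ltNge Z'P.
  by rewrite /Z' asboolF.
have mtail (z : R) : measurable ([set w : T | z < 0]).
  have [z0|z0] := ltP z 0.
    by rewrite (_ : [set _ | _] = setT)//; apply/seteqP; split.
  by rewrite (_ : [set _ | _] = set0)//; apply/seteqP; split.
have mZ' : measurable_fun setT Z'.
  apply: (measurability _ (RGenOInfty.measurableE R)) => _ [_ [z ->] <-].
  rewrite setTI (_ : _ @^-1` _ = [set w | z < Z' w]); last first.
    by apply/seteqP; split => w /=; rewrite /preimage/= in_itv/= andbT.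
  rewrite tailZ'; apply: measurableU; apply: measurableI => //.
  exact: measurableC.
exists Z'; split => //.
  apply: same_law_tails => // z; rewrite tailZ' -[LHS](Ulaw (g z))//.
  have mGU : measurable (G `&` [set w | U w < g z]) by exact: measurableI.
  have mGz : measurable (~` G `&` [set w : T | z < 0]).
    by apply: measurableI => //; exact: measurableC.
  apply/eqP; rewrite eq_le; apply/andP; split.
    rewrite (prDI P (mUl (g z)) mG) addrC -[leRHS]addr0; apply: lerD.
      by apply: pr_le; [exact: measurableI|exact: measurableU|move=> w [? ?]; left].
    rewrite -G1; apply: pr_le; [exact: measurableD|exact: measurableC|].
    by move=> w [].
  have mGG := measurableU _ _ mGU mGz.
  rewrite (prDI P mGG mG) -[leRHS]add0r; apply: lerD.
    rewrite -[leRHS]G1; apply: pr_le; [exact: measurableD|exact: measurableC|].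
    by move=> w [].
  apply: pr_le => //; first exact: measurableI.
  by move=> w [[[]//|[]//]].
exists (~` G); split => //; first exact: measurableC.
move=> w w' /contrapT Gw /contrapT Gw' XX; rewrite leNgt; apply/negP => ZZ.
have : U w' < U w.
  apply: (@lt_le_trans _ _ (g (Z' w))); last by rewrite -Z'P.
  by rewrite ltNge -Z'P// -ltNge.
by move=> /UX; rewrite leNgt XX.
Qed.

End rearrangement.

(** * Lebesgue measure on the real line *)

Section lebesgue.
Context {R : realType}.
Local Open Scope ereal_scope.

(* [lebesgue_measure] lives on [measurableTypeR R], whose display differs from
   that of the measurable structure of [R]. *)
Definition leb (A : set R) : \bar R := @lebesgue_measure R A.

Let leb0 : leb set0 = 0.
Proof. exact: (measure0 (@lebesgue_measure R)). Qed.

Let leb_ge0 A : 0 <= leb A.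
Proof. exact: (measure_ge0 (@lebesgue_measure R)). Qed.

Let leb_sigma_additive : semi_sigma_additive leb.
Proof.
exact: (@measure_semi_sigma_additive _ (measurableTypeR R) R (@lebesgue_measure R)).
Qed.

HB.instance Definition _ := isMeasure.Build _ _ _ leb
  leb0 leb_ge0 leb_sigma_additive.

Let leb_sigma_finite : sigma_finite setT leb.
Proof. exact: (@sigma_finiteT _ (measurableTypeR R) R (@lebesgue_measure R)). Qed.

HB.instance Definition _ := Measure_isSigmaFinite.Build _ _ _ leb leb_sigma_finite.

Lemma leb_itv (i : interval R) :
  leb [set` i] = (if i.1 < i.2 then (i.2 : \bar R) - i.1 else 0).
Proof. exact: lebesgue_measure_itv. Qed.

End lebesgue.

(** * The layer cake formula *)

Section layer_cake.
Context {d : measure_display} {T : measurableType d} {R : realType}.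
Variable m : {sigma_finite_measure set T -> \bar R}.
Local Open Scope ereal_scope.

Lemma measurable_subgraph (f : T -> \bar R) : measurable_fun setT f ->
  measurable [set p : T * R | p.2%:E < f p.1].
Proof.
move=> mf; have mD : measurable_fun setT (fun p : T * R => f p.1 - p.2%:E).
  apply: emeasurable_funB.
    by apply: (measurableT_comp mf); exact: measurable_fst.
  by apply/measurable_EFinP; exact: measurable_snd.
have := emeasurable_fun_o_infty measurableT mD 0; rewrite setTI.
rewrite (_ : [set _ | _] = [set p : T * R | p.2%:E < f p.1])//.
have E (y : \bar R) (r : R) : (0 < y - r%:E) = (r%:E < y).
  case: y => [s| |]; last by [].
    by rewrite -EFinB !lte_fin subr_gt0.
  by rewrite addye// !ltry.
by apply/seteqP; split => p /=; rewrite E.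
Qed.

(** The tail integral is a section integral of a nonnegative jointly measurable function, to which
    Tonelli applies. *)
Lemma measurable_tail_integral (g : T -> R) (f : T -> \bar R) :
  measurable_fun setT g -> measurable_fun setT f -> (forall x, (0 <= g x)%R) ->
  measurable_fun setT (fun y : R => \int[m]_(x in [set x | y%:E < f x]) (g x)%:E).
Proof.
move=> mg mf g0; pose A := [set p : T * R | p.2%:E < f p.1].
pose F (p : T * R) : \bar R := (g p.1 * \1_A p)%:E.
have mF : measurable_fun setT F.
  apply/measurable_EFinP/measurable_funM.
    by apply: (measurableT_comp mg); exact: measurable_fst.
  by apply: measurable_indic; exact: measurable_subgraph.
have F0 p : 0 <= F p by rewrite lee_fin mulr_ge0.
have := measurable_fun_fubini_tonelli_G (m1 := m) _ mF F0.
apply: eq_measurable_fun => y _; rewrite /fubini_G [RHS]integral_mkcond.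
apply: eq_integral => x _; rewrite /F patchE indicE /=.
case: ifPn => [/set_mem/= h|/negP h].
  by rewrite mem_set ?mulr1.
by rewrite memNset ?mulr0// => h'; apply: h; exact: mem_set.
Qed.

(** [maxe (f x) 0] is the length of the set of levels [y > 0] below [f x], also for infinite values;
    Tonelli exchanges the integrals over points and levels. *)
Lemma layer_cake (g : T -> R) (f : T -> \bar R) : measurable_fun setT g ->
  measurable_fun setT f -> (forall x, (0 <= g x)%R) ->
  \int[m]_x ((g x)%:E * maxe (f x) 0) =
  \int[leb]_(y in `]0%R, +oo[) \int[m]_(x in [set x | y%:E < f x]) (g x)%:E.
Proof.
move=> mg mf g0.
pose A := [set p : T * R | p.2%:E < f p.1] `&` [set p : T * R | (0 < p.2)%R].
have mA : measurable A.
  apply: measurableI; first exact: measurable_subgraph.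
  apply: measurable_lt_set => //; exact: measurable_snd.
pose F (p : T * R) : \bar R := (g p.1 * \1_A p)%:E.
have mF : measurable_fun setT F.
  apply/measurable_EFinP/measurable_funM; last exact: measurable_indic.
  by apply: (measurableT_comp mg); exact: measurable_fst.
have F0 p : 0 <= F p by rewrite lee_fin mulr_ge0.
transitivity (\int[m]_x \int[leb]_y F (x, y)).
  apply: eq_integral => x _; rewrite /F/=.
  have [B [mB BE Bm]] : exists B : set R, [/\ measurable B,
      B = [set y | y%:E < f x] `&` [set y | (0 < y)%R] & leb B = maxe (f x) 0].
    case: (f x) => [r| |].
    - exists `]0%R, r[%classic; split => //.
        apply/seteqP; split => y /=; rewrite in_itv/= lte_fin.
          by move=> /andP[? ?]; split.
        by move=> [-> ->].
      rewrite leb_itv/= lte_fin; case: ltP => r0.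
        by rewrite sube0 max_l// lee_fin ltW.
      by rewrite max_r// lee_fin.
    - exists `]0%R, +oo[%classic; split => //.
        apply/seteqP; split => y /=; rewrite in_itv/= andbT ltry.
          by split.
        by move=> [].
      by rewrite leb_itv/= ltry max_l ?leey.
    - exists set0; split => //; last by rewrite measure0 max_r.
      by apply/seteqP; split => y // -[].
  have -> : (fun y : R => (g x * \1_A (x, y))%:E) =
      (fun y : R => (g x)%:E * (\1_B y)%:E).
    by apply/funext => y; rewrite EFinM BE; congr (_ * (_ : R)%:E).
  rewrite ge0_integralZl//=; last 2 first.
  - by apply/measurable_EFinP; exact: measurable_indic.
  - by rewrite lee_fin.
  by rewrite integral_indic// setIT -Bm.
rewrite (fubini_tonelli (m1 := m) (m2 := leb) _ mF F0) [RHS]integral_mkcond.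
apply: eq_integral => y _; rewrite patchE; case: ifPn => [/set_mem|/negP h].
  rewrite /= in_itv/= andbT => y0; rewrite [RHS]integral_mkcond.
  apply: eq_integral => x _; rewrite /F patchE indicE /=.
  case: ifPn => [/set_mem/= h|/negP h].
    by rewrite mem_set ?mulr1.
  by rewrite memNset ?mulr0// => -[h' _]; apply: h; exact: mem_set.
apply: integral0_eq => x _; rewrite /F indicE memNset ?mulr0// => -[_ /= y0].
by apply: h; apply/mem_set; rewrite /= in_itv/= y0.
Qed.

Lemma layer_cake_EFin (g f : T -> R) : measurable_fun setT g ->
  measurable_fun setT f -> (forall x, (0 <= g x)%R) ->
  \int[m]_x (g x * Num.max (f x) 0%R)%:E =
  \int[leb]_(y in `]0%R, +oo[) \int[m]_(x in [set x | (y < f x)%R]) (g x)%:E.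
Proof.
move=> mg /measurable_EFinP mf g0; rewrite -[RHS](layer_cake mg mf g0).
apply: eq_integral => x _; rewrite EFinM; congr (_ * _) => /=.
by rewrite EFin_max.
Qed.

Lemma measurable_tail_integral_EFin (g f : T -> R) :
  measurable_fun setT g -> measurable_fun setT f -> (forall x, (0 <= g x)%R) ->
  measurable_fun setT (fun y : R => \int[m]_(x in [set x | (y < f x)%R]) (g x)%:E).
Proof.
by move=> mg /measurable_EFinP mf g0; have := measurable_tail_integral mg mf g0.
Qed.

End layer_cake.

(** * Layers of a nonnegative function over an event *)

Section layers.
Context {d : measure_display} {T : measurableType d} {R : realType}.
Variable P : probability T R.
Local Open Scope ereal_scope.

(** Layer cake with the indicator of [A] as weight. *)
Lemma integral_layers (Z : T -> R) (A : set T) : measurable_fun setT Z ->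
  measurable A -> (forall x, (0 <= Z x)%R) ->
  \int[P]_(x in A) (Z x)%:E = \int[leb]_(y in `]0%R, +oo[) (pr P (A `&` [set x | (y < Z x)%R]))%:E.
Proof.
move=> mZ mA Z0; have mZl (y : R) : measurable [set x | (y < Z x)%R] by exact: measurable_lt_set.
have mi : measurable_fun setT (\1_A : T -> R) by exact: measurable_indic.
transitivity (\int[P]_x (\1_A x * Num.max (Z x) 0%R)%:E).
  rewrite integral_mkcond; apply: eq_integral => x _; rewrite patchE indicE.
  by case: (x \in A); rewrite ?mul0r// mul1r max_l.
rewrite (layer_cake_EFin P)//; apply: eq_integral => y _.
by rewrite integral_indic// -prE//; exact: measurableI.
Qed.

Lemma lt_max0_set (f : T -> R) (y : R) : (0 < y)%R ->
  [set x | (y < Num.max (f x) 0)%R] = [set x | (y < f x)%R].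
Proof.
move=> y0; apply/seteqP; split => x /=; rewrite lt_max; last by move=> ->.
by move=> /orP[//|/(lt_trans y0)]; rewrite ltxx.
Qed.

Lemma integral_tail (Z : T -> R) : measurable_fun setT Z ->
  {ae P, forall x, (0 <= Z x)%R} ->
  \int[P]_x (Z x)%:E = \int[leb]_(y in `]0%R, +oo[) (pr P [set x | (y < Z x)%R])%:E.
Proof.
move=> mZ Z0; have mM : measurable_fun setT (fun x => Num.max (Z x) 0%R).
  exact: measurable_maxr.
transitivity (\int[P]_x (Num.max (Z x) 0)%:E).
  apply: ae_eq_integral => //; [exact/measurable_EFinP|exact/measurable_EFinP|].
  by apply: filterS Z0 => x Zx _; rewrite max_l.
rewrite integral_layers//; last by move=> x; rewrite le_max lexx orbT.
apply: eq_integral => y; rewrite inE/= in_itv/= andbT => y0.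
by rewrite setTI lt_max0_set.
Qed.

Lemma measurable_layers (Z : T -> R) (A : set T) : measurable_fun setT Z ->
  measurable A ->
  measurable_fun setT (fun y : R => (pr P (A `&` [set x | (y < Z x)%R]))%:E).
Proof.
move=> mZ mA; have mZl (y : R) : measurable [set x | (y < Z x)%R] by exact: measurable_lt_set.
have mi : measurable_fun setT (\1_A : T -> R) by exact: measurable_indic.
have := @measurable_tail_integral_EFin _ _ _ P (\1_A) Z mi mZ.
move=> /(_ (fun x => ler0n _ _)); apply: eq_measurable_fun => y _.
by rewrite integral_indic// -prE//; exact: measurableI.
Qed.

End layers.

(** * Comparison of expectations through joint tails *)

Section comparison.
Context {d : measure_display} {T : measurableType d} {R : realType}.
Variable P : probability T R.
Local Open Scope ereal_scope.
Implicit Types X W Z : T -> R.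

(** The layers of [X^+] and [X^-] are compared separately; subtraction is then monotone whichever
    values are infinite. *)
Lemma EQ_le_tails W W' X X' : measurable_fun setT W -> measurable_fun setT W' ->
  measurable_fun setT X -> measurable_fun setT X' ->
  (forall x, (0 <= W x)%R) -> (forall x, (0 <= W' x)%R) ->
  (forall c : R, (0 < c)%R -> \int[P]_(x in [set x | (c < X' x)%R]) (W' x)%:E <=
                        \int[P]_(x in [set x | (c < X x)%R]) (W x)%:E) ->
  (forall c : R, (0 < c)%R -> \int[P]_(x in [set x | (c < - X x)%R]) (W x)%:E <=
                        \int[P]_(x in [set x | (c < - X' x)%R]) (W' x)%:E) ->
  EQ P W' X' <= EQ P W X.
Proof.
move=> mW mW' mX mX' W0 W'0 Hp Hn.
have mN (Y : T -> R) : measurable_fun setT Y -> measurable_fun setT (fun x => - Y x)%R.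
  by move=> mY; exact: measurable_funN.
have mNX := mN _ mX; have mNX' := mN _ mX'.
rewrite /EQ; apply: leeB.
  rewrite !(layer_cake_EFin P)//; apply: ge0_le_integral => //.
  - by move=> y _; apply: integral_ge0 => x _; rewrite lee_fin.
  - by apply: measurable_funTS; exact: measurable_tail_integral_EFin.
  - by apply: measurable_funTS; exact: measurable_tail_integral_EFin.
  - by move=> y /=; rewrite in_itv/= andbT => y0; exact: Hp.
rewrite (layer_cake_EFin P mW mNX)// (layer_cake_EFin P mW' mNX')//; apply: ge0_le_integral => //.
- by move=> y _; apply: integral_ge0 => x _; rewrite lee_fin.
- by apply: measurable_funTS; exact: measurable_tail_integral_EFin.
- by apply: measurable_funTS; exact: measurable_tail_integral_EFin.
- by move=> y /=; rewrite in_itv/= andbT => y0; exact: Hn.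
Qed.

Lemma EQ_ae Z Z' X : measurable_fun setT Z -> measurable_fun setT Z' ->
  measurable_fun setT X -> {ae P, forall x, Z x = Z' x} -> EQ P Z X = EQ P Z' X.
Proof.
move=> mZ mZ' mX ZZ; rewrite /EQ.
have mXp : measurable_fun setT (fun x => Num.max (X x) 0%R) by exact: measurable_maxr.
have mXn : measurable_fun setT (fun x => Num.max (- X x)%R 0%R).
  by apply: measurable_maxr => //; exact: measurable_funN.
congr (_ - _); apply: ae_eq_integral => //.
- by apply/measurable_EFinP; exact: measurable_funM.
- by apply/measurable_EFinP; exact: measurable_funM.
- by apply: filterS ZZ => x Zx _; rewrite Zx.
- by apply/measurable_EFinP; exact: measurable_funM.
- by apply/measurable_EFinP; exact: measurable_funM.
- by apply: filterS ZZ => x Zx _; rewrite Zx.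
Qed.

(** Replaces almost sure nonnegativity by nonnegativity everywhere, as the layer formulas
    require. *)
Lemma EQ_max0 Z X : measurable_fun setT Z -> measurable_fun setT X ->
  {ae P, forall x, (0 <= Z x)%R} -> EQ P Z X = EQ P (fun x => Num.max (Z x) 0%R) X.
Proof.
move=> mZ mX Z0; apply: EQ_ae => //; first exact: measurable_maxr.
by apply: filterS Z0 => x Zx; rewrite max_l.
Qed.

(** The first three terms depend on the marginals only, so the intersection is smallest when the
    complements meet in a null set. *)
Lemma prIE (A B : set T) : measurable A -> measurable B ->
  (pr P (A `&` B) = pr P A + pr P B - 1 + pr P (~` A `&` ~` B))%R.
Proof.
move=> mA mB; have := prC P mB; have := prDI P mA mB; rewrite setDE.
have := prDI P (measurableC mB) mA; rewrite setDE setIC [X in (_ + pr P X)%R]setIC; lra.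
Qed.

(** Points [w] of the first intersection and [w'] of the second, both outside the exceptional null
    set, would satisfy [X w' < X w] and [Z w' < Z w]. The joint tail thus attains the lower Frechet
    bound. *)
Lemma antimonotone_tails X Z (x z : R) : measurable_fun setT X -> measurable_fun setT Z ->
  antimonotone P X Z ->
  let A := [set w | (x < X w)%R] in let B := [set w | (z < Z w)%R] in
  pr P (A `&` B) = 0%R \/ pr P (~` A `&` ~` B) = 0%R.
Proof.
move=> mX mZ [N [mN N0 XZ]] A B.
have mA : measurable A by exact: measurable_lt_set.
have mB : measurable B by exact: measurable_lt_set.
have null C : measurable C -> C `<=` N -> pr P C = 0%R.
  move=> mC CN; apply/eqP; rewrite eq_le pr_ge0 andbT -N0; exact: pr_le.
have [AB|AB] := pselect (A `&` B `<=` N); [left|right].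
  by apply: null => //; exact: measurableI.
apply: null; first by apply: measurableI; exact: measurableC.
move=> w' [/negP + /negP]; rewrite -!leNgt => Xw' Zw'.
apply: contrapT => Nw'; apply: AB => w [Aw Bw]; apply: contrapT => Nw.
have := XZ w' w Nw' Nw (le_lt_trans Xw' Aw); rewrite leNgt => /negP; apply.
exact: le_lt_trans Bw.
Qed.

(** Low values of [X] go with high values of [Z], so the two events are nested up to a null set and
    the upper Frechet bound is attained. *)
Lemma antimonotone_lower_tails X Z (x z : R) : measurable_fun setT X -> measurable_fun setT Z ->
  antimonotone P X Z ->
  let C := [set w | (x < - X w)%R] in let B := [set w | (z < Z w)%R] in
  pr P (C `&` B) = pr P C \/ pr P (C `&` B) = pr P B.
Proof.
move=> mX mZ [N [mN N0 XZ]] C B.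
have mC : measurable C by apply: measurable_lt_set => //; exact: measurable_funN.
have mB : measurable B by exact: measurable_lt_set.
have null D : measurable D -> D `<=` N -> pr P D = 0%R.
  move=> mD DN; apply/eqP; rewrite eq_le pr_ge0 andbT -N0; exact: pr_le.
have [CB|CB] := pselect (C `\` B `<=` N); [left|right].
  by apply: pr_eq0_le => //; apply: null => //; exact: measurableD.
rewrite setIC; apply: pr_eq0_le => //; apply: null; first exact: measurableD.
move=> w' [Bw' /negP]; rewrite -leNgt => Cw'.
apply: contrapT => Nw'; apply: CB => w [Cw /negP]; rewrite -leNgt => Bw.
apply: contrapT => Nw.
have XX : (X w < X w')%R by rewrite -ltrN2; exact: le_lt_trans Cw.
have := XZ w w' Nw Nw' XX; rewrite leNgt => /negP; apply.
exact: le_lt_trans Bw'.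
Qed.

Lemma same_law_tail X X' : same_law P X X' -> forall x : R,
  pr P [set w | (x < X w)%R] = pr P [set w | (x < X' w)%R].
Proof.
move=> XX x; have tail (Z : T -> R) : [set w | (x < Z w)%R] = Z @^-1` `]x, +oo[.
  by apply/seteqP; split => w /=; rewrite /preimage/= in_itv/= andbT.
by rewrite !tail; exact: same_law_pr.
Qed.

Lemma same_law_lower_tail X X' : same_law P X X' -> forall x : R,
  pr P [set w | (x < - X w)%R] = pr P [set w | (x < - X' w)%R].
Proof.
move=> XX x; have tail (Z : T -> R) : [set w | (x < - Z w)%R] = Z @^-1` `]-oo, (- x)%R[.
  by apply/seteqP; split => w /=; rewrite /preimage/= in_itv/= ltrNr.
by rewrite !tail; exact: same_law_pr.
Qed.

Lemma same_law_ae Z Z' (B : set R) : measurable_fun setT Z ->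
  measurable_fun setT Z' -> measurable B -> same_law P Z Z' ->
  {ae P, forall x, B (Z x)} -> {ae P, forall x, B (Z' x)}.
Proof.
move=> mZ mZ' mB ZZ [N [mN N0 NZ]]; exists (Z' @^-1` ~` B); split => //.
- exact: measurable_preimageT (measurableC mB).
- rewrite -ZZ; last exact: measurableC.
  by apply: subset_measure0 N0 => //; exact: measurable_preimageT (measurableC mB).
Qed.

Lemma same_law_ge0 Z Z' : measurable_fun setT Z -> measurable_fun setT Z' ->
  same_law P Z Z' ->
  {ae P, forall x, (0 <= Z x)%R} -> {ae P, forall x, (0 <= Z' x)%R}.
Proof.
move=> mZ mZ' ZZ Z0.
have mB : measurable [set r : R | (0 <= r)%R] by exact: measurable_le_set.
exact: (same_law_ae mZ mZ' mB ZZ Z0).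
Qed.

(** Layers in both variables reduce the claim to joint tails. For an antimonotone pair the events
    [X' > c] and [Z' > y] have the smallest intersection their probabilities allow, the events
    [- X' > c] and [Z' > y] the largest. *)
Lemma hardy_littlewood Z Z' X X' : measurable_fun setT Z -> measurable_fun setT Z' ->
  measurable_fun setT X -> measurable_fun setT X' ->
  {ae P, forall x, (0 <= Z x)%R} -> same_law P Z Z' -> same_law P X X' ->
  antimonotone P X' Z' -> EQ P Z' X' <= EQ P Z X.
Proof.
move=> mZ mZ' mX mX' Z0 ZZ XX XZ'.
rewrite (EQ_max0 mZ' mX' (same_law_ge0 mZ mZ' ZZ Z0)) (EQ_max0 mZ mX Z0).
have mM (Y : T -> R) : measurable_fun setT Y -> measurable_fun setT (fun x => Num.max (Y x) 0%R).
  by move=> mY; exact: measurable_maxr.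
have M0 (Y : T -> R) x : (0 <= Num.max (Y x) 0)%R by rewrite le_max lexx orbT.
have ml (Y : T -> R) (y : R) : measurable_fun setT Y -> measurable [set x | (y < Y x)%R].
  by move=> mY; exact: measurable_lt_set.
have mn (Y : T -> R) (y : R) : measurable_fun setT Y -> measurable [set x | (y < - Y x)%R].
  by move=> mY; apply: measurable_lt_set => //; exact: measurable_funN.
apply: EQ_le_tails => //; try exact: mM.
- move=> c c0; rewrite !integral_layers//; try exact: mM; try exact: ml.
  apply: ge0_le_integral => //.
  + by move=> y _; rewrite lee_fin pr_ge0.
  + by apply: measurable_funTS; apply: measurable_layers; [exact: mM|exact: ml].
  + by apply: measurable_funTS; apply: measurable_layers; [exact: mM|exact: ml].
  + move=> y /=; rewrite in_itv/= andbT => y0; rewrite lee_fin !lt_max0_set//.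
    have [->|AB] := @antimonotone_tails X' Z' c y mX' mZ' XZ'; first exact: pr_ge0.
    rewrite prIE; [|exact: ml|exact: ml]; rewrite AB.
    rewrite [leRHS]prIE; [|exact: ml|exact: ml].
    by rewrite (same_law_tail ZZ) (same_law_tail XX) lerD2l pr_ge0.
- move=> c c0; rewrite !integral_layers//; try exact: mM; try exact: mn.
  apply: ge0_le_integral => //.
  + by move=> y _; rewrite lee_fin pr_ge0.
  + by apply: measurable_funTS; apply: measurable_layers; [exact: mM|exact: mn].
  + by apply: measurable_funTS; apply: measurable_layers; [exact: mM|exact: mn].
  + move=> y /=; rewrite in_itv/= andbT => y0; rewrite lee_fin !lt_max0_set//.
    have mI : measurable ([set x | (c < - X x)%R] `&` [set x | (y < Z x)%R]).
      by apply: measurableI; [exact: mn|exact: ml].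
    have [->|->] := @antimonotone_lower_tails X' Z' c y mX' mZ' XZ'.
      rewrite -(same_law_lower_tail XX); apply: pr_le => //; exact: mn.
    rewrite -(same_law_tail ZZ); apply: pr_le => //; exact: ml.
Qed.

End comparison.

(** * Law invariance of utilities and determining sets *)

Section law_invariance.
Context {d : measure_display} {T : measurableType d} {R : realType}.
Variable P : probability T R.
Local Open Scope ereal_scope.
Implicit Types (X W Z : T -> R) (D : set (T -> R)).

Lemma same_law_density Z Z' : density P Z -> measurable_fun setT Z' ->
  same_law P Z Z' -> density P Z'.
Proof.
move=> [mZ Z0 Z1] mZ' ZZ; have Z'0 := same_law_ge0 mZ mZ' ZZ Z0.
split => //; rewrite -Z1 !integral_tail//; apply: eq_integral => y _.
by rewrite (same_law_tail ZZ).
Qed.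

(** Each [Z] in [D] is replaced by its copy antimonotone to [X'], which stays in [D] and gives [X']
    an expectation no larger than that of [X] under [Z]. Symmetry gives equality. *)
Lemma inf_EQ_same_law D X X' : atomless P -> D `<=` density P ->
  law_invariant_set P D -> measurable_fun setT X -> measurable_fun setT X' ->
  same_law P X X' ->
  ereal_inf [set EQ P Z X | Z in D] = ereal_inf [set EQ P Z X' | Z in D].
Proof.
move=> aP dD lD; wlog suff le : X X' / measurable_fun setT X ->
    measurable_fun setT X' -> same_law P X X' ->
    ereal_inf [set EQ P Z X' | Z in D] <= ereal_inf [set EQ P Z X | Z in D].
  move=> mX mX' XX; apply/eqP; rewrite eq_le !le//; exact: same_law_sym.
move=> mX mX' XX; apply: le_ereal_inf_tmp => _ [Z DZ <-].
have [mZ Z0 _] := dD _ DZ.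
have [Z' [mZ' ZZ XZ']] := exists_antimonotone aP mX' mZ.
apply: le_trans (hardy_littlewood mZ mZ' mX mX' Z0 ZZ XX XZ').
by apply: ereal_inf_lbound; exists Z' => //; exact: lD ZZ.
Qed.

(** Here [X] is rearranged, not [Z]: for a copy [X'] of [X] antimonotone to [Z],
    [u X = u X' <= EQ P Z X' <= EQ P Z' X]. *)
Lemma detset_law_invariant u : atomless P -> law_invariant_u P u ->
  law_invariant_set P (detset P u).
Proof.
move=> aP lu Z Z' [dZ uZ] mZ' ZZ; have [mZ Z0 _] := dZ.
split=> [|X mX]; first exact: same_law_density ZZ.
have [X' [mX' XX ZX']] := exists_antimonotone aP mZ mX.
have Z'0 := same_law_ge0 mZ mZ' ZZ Z0.
rewrite (lu _ _ mX mX' XX); apply: le_trans (uZ _ mX') _.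
apply: hardy_littlewood => //; first exact: same_law_sym.
exact: antimonotone_sym.
Qed.

(** The upper bound imposed on a density constrains its law only. *)
Lemma ulam_same_law l X X' : atomless P -> measurable_fun setT X ->
  measurable_fun setT X' -> same_law P X X' -> ulam P l X = ulam P l X'.
Proof.
move=> aP mX mX' XX; apply: inf_EQ_same_law => // [Z []//|].
move=> Z Z' [dZ Zl] mZ' ZZ; split; first exact: same_law_density ZZ.
have [mZ _ _] := dZ.
have mB : measurable [set r : R | (r <= l^-1)%R] by exact: measurable_le_set.
exact: (same_law_ae mZ mZ' mB ZZ Zl).
Qed.

Lemma umu_law_invariant mu : atomless P -> law_invariant_u P (umu P mu).
Proof.
move=> aP X X' mX mX' XX.
have E l : ulam P l X = ulam P l X' by exact: ulam_same_law.
have Ep : (fun l => maxe (ulam P l X) 0) = (fun l => maxe (ulam P l X') 0).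
  by apply/funext => l; rewrite E.
have En : (fun l => maxe (- ulam P l X) 0) = (fun l => maxe (- ulam P l X') 0).
  by apply/funext => l; rewrite E.
by rewrite /umu Ep En.
Qed.

(** The determining set contains every set that represents [u], and none of its members has an
    expectation below [u]. *)
Lemma coherent_utility_detset u : coherent_utility P u -> forall X,
  measurable_fun setT X -> u X = ereal_inf [set EQ P Z X | Z in detset P u].
Proof.
move=> [D [_ dD uD]] X mX; apply/eqP; rewrite eq_le; apply/andP; split.
  by apply: le_ereal_inf_tmp => _ [Z [_ uZ] <-]; exact: uZ.
rewrite uD//; apply: le_ereal_inf_tmp => _ [Z DZ <-].
apply: ereal_inf_lbound; exists Z => //; split; first exact: dD.
by move=> Y mY; rewrite uD//; apply: ereal_inf_lbound; exists Z.
Qed.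

Lemma law_invariant_detset u : atomless P -> coherent_utility P u ->
  law_invariant_set P (detset P u) -> law_invariant_u P u.
Proof.
move=> aP cu lD X X' mX mX' XX; rewrite !(coherent_utility_detset cu)//.
by apply: inf_EQ_same_law => // Z [].
Qed.

Lemma ulam_le l l' X : (0 < l)%R -> (l <= l')%R -> ulam P l X <= ulam P l' X.
Proof.
move=> l0 ll; apply: le_ereal_inf_tmp => _ [Z [dZ Zl] <-].
apply: ereal_inf_lbound; exists Z => //; split => //.
apply: filterS Zl => x /le_trans; apply.
by rewrite lef_pV2 ?posrE//; exact: lt_le_trans ll.
Qed.

(** Monotonicity in [l] makes the inverse images of half-lines intervals. *)
Lemma measurable_ulam X :
  measurable_fun ([set` `]0%R, 1%R]] : set R) (fun l : R => ulam P l X).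
Proof.
move=> mD; apply: (measurability _ (ErealGenCInfty.measurableE R)) => //.
move=> _ [_ [x ->] <-]; apply: is_interval_measurable.
move=> a b [/= + xa] [/= + xb] c /andP[ac cb]; rewrite !in_itv/= => /andP[a0 _] /andP[_ b1].
split => /=.
  by rewrite (lt_le_trans a0)//= (le_trans cb).
move: xa; rewrite /= !in_itv/= !andbT => xa; apply: (le_trans xa).
exact: ulam_le.
Qed.

End law_invariance.

(** * The bathtub principle for [ulam] *)

Section bathtub.
Context {d : measure_display} {T : measurableType d} {R : realType}.
Variable P : probability T R.
Local Open Scope ereal_scope.
Implicit Types (X W Z : T -> R).

(** A positive factor preserves the convention that [+oo - +oo] is [-oo]. *)
Lemma muleBr_ge0 (l : R) (a b : \bar R) : (0 < l)%R -> 0 <= a -> 0 <= b ->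
  l%:E * (a - b) = l%:E * a - l%:E * b.
Proof.
move=> l0; case: a => [a| |]//; case: b => [b| |]// _ _.
- by rewrite -EFinB -!EFinM -EFinB mulrBr.
- by rewrite /= gt0_muleNy ?lte_fin// gt0_muley ?lte_fin.
- by rewrite /= gt0_muley ?lte_fin.
- by rewrite /= gt0_muleNy ?lte_fin// gt0_muley ?lte_fin.
Qed.

(** The mass on [C] is at most [k * pr P C], hence finite; real values then permit linear
    arithmetic. *)
Lemma integral_bounded_density W (k : R) : measurable_fun setT W ->
  (forall x, (0 <= W x <= k)%R) -> \int[P]_x (W x)%:E = 1 -> (forall C, measurable C ->
  exists i : R, [/\ \int[P]_(x in C) (W x)%:E = i%:E,
    \int[P]_(x in ~` C) (W x)%:E = (1 - i)%:E & (0 <= i <= k * pr P C)%R ]).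
Proof.
move=> mW W0k W1 C mC.
have W0 (x : T) : (0 <= (W x)%:E) by rewrite lee_fin; have /andP[] := W0k x.
have mWE (D : set T) : measurable_fun D (EFin \o W).
  by apply: measurable_funTS; exact/measurable_EFinP.
have split : \int[P]_(x in C) (W x)%:E + \int[P]_(x in ~` C) (W x)%:E = 1.
  rewrite -W1 -ge0_integral_setU//; first by rewrite setUv.
  - exact: measurableC.
  - by apply/disj_setPCl.
have iC : \int[P]_(x in C) (W x)%:E <= (k * pr P C)%:E.
  apply: (@le_trans _ _ (\int[P]_(x in C) k%:E)).
    apply: ge0_le_integral => //.
    by move=> x _; rewrite lee_fin; have /andP[] := W0k x.
  by rewrite integral_cst// EFinM -prE.
have i0 : 0 <= \int[P]_(x in C) (W x)%:E by apply: integral_ge0.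
move: iC i0 split; case: (\int[P]_(x in C) (W x)%:E) => [i| |]//.
rewrite !lee_fin => iC i0; case: (\int[P]_(x in ~` C) (W x)%:E) => [j| |]//.
by rewrite -EFinD => -[ij]; exists i; split => //; [congr EFin; lra|rewrite i0].
Qed.

(** The minimiser is the uniform density on [A], the event carrying the lowest values of [X]. A
    competitor bounded by [l^-1] puts at least as much mass on upper tails of [X] and at most as
    much on lower tails. *)
Lemma ulam_antimonotone X Z (y : R) (A := [set w | (y < Z w)%R]) (l := pr P A) :
  measurable_fun setT X -> measurable_fun setT Z -> antimonotone P X Z ->
  (0 < l)%R -> l%:E * ulam P l X =
  \int[P]_(x in A) (Num.max (X x) 0)%:E - \int[P]_(x in A) (Num.max (- X x) 0)%:E.
Proof.
move=> mX mZ XZ l0; have mA : measurable A by exact: measurable_lt_set.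
have l0' : (0 < l^-1)%R by rewrite invr_gt0.
pose W0 := (fun w => l^-1 * \1_A w)%R.
have mi : measurable_fun setT (\1_A : T -> R) by exact: measurable_indic.
have mW0 : measurable_fun setT W0 by exact: measurable_funM.
have W0l w : (0 <= W0 w <= l^-1)%R.
  by rewrite /W0 indicE; case: (w \in A); rewrite ?mulr1 ?mulr0 ?lexx ?ltW.
have W0_ge0 w : (0 <= W0 w)%R by have /andP[] := W0l w.
have iW0 C : measurable C -> \int[P]_(x in C) (W0 x)%:E = (l^-1 * pr P (C `&` A))%:E.
  move=> mC; rewrite /W0; under eq_integral do rewrite EFinM.
  rewrite ge0_integralZl//; last by rewrite lee_fin ltW.
    by rewrite integral_indic// EFinM -prE 1?setIC//; exact: measurableI.
  by apply: measurable_funTS; exact/measurable_EFinP.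
have iXW0 (Y : T -> R) : measurable_fun setT Y -> (forall x, (0 <= Y x)%R) ->
    l%:E * \int[P]_x (W0 x * Y x)%:E = \int[P]_(x in A) (Y x)%:E.
  move=> mY Y0; rewrite -ge0_integralZl//; first last.
  - by rewrite lee_fin ltW.
  - by move=> x _; rewrite lee_fin mulr_ge0.
  - by apply/measurable_EFinP; exact: measurable_funM.
  rewrite [RHS]integral_mkcond; apply: eq_integral => x _.
  rewrite patchE /W0 indicE -EFinM; case: ifP => _; last by rewrite mulr0 mul0r mulr0.
  by rewrite mulr1 mulrA divff ?mul1r// gt_eqF.
suff -> : ulam P l X = EQ P W0 X.
  rewrite /EQ muleBr_ge0//; first last.
  - by apply: integral_ge0 => x _; rewrite lee_fin mulr_ge0// le_max lexx orbT.
  - by apply: integral_ge0 => x _; rewrite lee_fin mulr_ge0// le_max lexx orbT.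
  rewrite !iXW0//.
  - by apply: measurable_maxr => //; exact: measurable_funN.
  - by move=> x; rewrite le_max lexx orbT.
  - by apply: measurable_maxr.
  - by move=> x; rewrite le_max lexx orbT.
apply/eqP; rewrite eq_le; apply/andP; split.
  apply: ereal_inf_lbound; exists W0 => //; split.
    split => //; first exact: aeW.
    by rewrite iW0// setTI mulVf// gt_eqF.
  by apply: aeW => x; have /andP[] := W0l x.
apply: le_ereal_inf_tmp => _ [W [[mW W_ge0 W1] Wl] <-].
(* Clipping changes [W] on a null set only and makes both bounds hold everywhere. *)
pose Wt := fun x => Num.min (Num.max (W x) 0%R) l^-1%R.
have mWt : measurable_fun setT Wt.
  by apply: measurable_minr => //; exact: measurable_maxr.
have Wt0l x : (0 <= Wt x <= l^-1)%R.
  by rewrite /Wt le_min le_max lexx orbT (ltW l0')/= ge_min lexx orbT.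
have WWt : {ae P, forall x, W x = Wt x}.
  by apply: filterS2 W_ge0 Wl => x h1 h2; rewrite /Wt max_l// min_l.
have Wt1 : \int[P]_x (Wt x)%:E = 1.
  rewrite -W1; apply: ae_eq_integral => //; [exact/measurable_EFinP|exact/measurable_EFinP|].
  by apply: filterS WWt => x -> _.
rewrite (EQ_ae mW mWt mX WWt).
have Wint := integral_bounded_density mWt Wt0l Wt1.
apply: EQ_le_tails => // [x|c c0|c c0]; first by have /andP[] := Wt0l x.
(* The mass on an upper tail is least when the complement is filled to density [l^-1], as [W0] does
   unless it puts no mass on the tail at all. *)
- have mB : measurable [set x | (c < X x)%R] by exact: measurable_lt_set.
  rewrite iW0//; have [i [-> iE /andP[i0 ik]]] := Wint _ mB.
  have [j [jE _ /andP[j0 jk]]] := Wint _ (measurableC mB).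
  have ij : i = (1 - j)%R by move: jE; rewrite iE => -[<-]; lra.
  rewrite lee_fin.
  have [->|AB] := @antimonotone_tails _ _ _ P X Z c y mX mZ XZ; first by rewrite mulr0.
  rewrite prIE// AB addr0 ij mulrBr mulrDr mulVf ?gt_eqF//.
  move: jk; rewrite prC// mulrBr; lra.
(* The mass on a lower tail is at most 1 and at most [l^-1] times its probability; [W0] attains one
   of these bounds. *)
- have mC : measurable [set x | (c < - X x)%R].
    by apply: measurable_lt_set => //; exact: measurable_funN.
  rewrite iW0//; have [i [-> iC /andP[i0 ik]]] := Wint _ mC.
  rewrite lee_fin.
  have [->//|->] := @antimonotone_lower_tails _ _ _ P X Z c y mX mZ XZ.
  rewrite mulVf ?gt_eqF// -subr_ge0 -lee_fin -iC.
  by apply: integral_ge0 => x _; rewrite lee_fin; have /andP[] := Wt0l x.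
Qed.

End bathtub.

(** * Probability measures with a density *)

Section density_measure.
Context {d : measure_display} {T : measurableType d} {R : realType}.
Variables (m : {sigma_finite_measure set T -> \bar R}) (h : T -> R).
Local Open Scope ereal_scope.

(** The properties of [h] are arguments of the term so that measure and probability structures can
    be attached to it. *)
Definition density_measure (mh : measurable_fun setT h)
    (h0 : forall x, (0 <= h x)%R) (h1 : \int[m]_x (h x)%:E = 1) (A : set T) :=
  \int[m]_(x in A) (h x)%:E.

Hypotheses (mh : measurable_fun setT h) (h0 : forall x, (0 <= h x)%R)
  (h1 : \int[m]_x (h x)%:E = 1).
Local Notation nu := (density_measure mh h0 h1).

Let nu0 : nu set0 = 0.
Proof. by rewrite /density_measure integral_set0. Qed.

Let nu_ge0 A : 0 <= nu A.
Proof. by apply: integral_ge0 => x _; rewrite lee_fin. Qed.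

Let nu_sigma_additive : semi_sigma_additive nu.
Proof.
move=> F mF tF mUF; rewrite /density_measure; apply: cvg_toP.
  apply: ereal_nondecreasing_is_cvgn => i j ij.
  by apply: lee_sum_nneg_natr => // k _ _; exact: nu_ge0.
rewrite ge0_integral_bigcup//=.
- by apply: measurable_funTS; exact/measurable_EFinP.
- by move=> x _; rewrite lee_fin.
Qed.

HB.instance Definition _ := isMeasure.Build _ _ _ nu nu0 nu_ge0 nu_sigma_additive.

Let nuT : nu setT = 1. Proof. exact: h1. Qed.

HB.instance Definition _ := Measure_isProbability.Build _ _ _ nu nuT.

(* Both sides have the same layers. *)
Lemma integral_density_measure (f : T -> \bar R) : measurable_fun setT f ->
  (forall x, 0 <= f x) -> \int[nu]_x f x = \int[m]_x ((h x)%:E * f x).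
Proof.
move=> mf f0.
transitivity (\int[nu]_x ((cst 1%R x)%:E * maxe (f x) 0)).
  by apply: eq_integral => x _; rewrite mul1e max_l.
transitivity (\int[m]_x ((h x)%:E * maxe (f x) 0)); last first.
  by apply: eq_integral => x _; rewrite max_l.
rewrite (@layer_cake _ _ _ nu)// layer_cake//; apply: eq_integral => y _.
have mS : measurable [set x | y%:E < f x].
  by have := emeasurable_fun_o_infty measurableT mf y%:E; rewrite setTI.
rewrite -[LHS]/(\int[nu]_(x in [set x | y%:E < f x]) cst 1 x).
by rewrite integral_cst// mul1e.
Qed.

End density_measure.

(** * Mixing measures *)

Section mixture.
Context {d : measure_display} {T : measurableType d} {R : realType}.
Variable P : probability T R.
Local Open Scope ereal_scope.
Implicit Types (X Z : T -> R) (mu : probability R R).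

Local Notation tail Z := (fun y : R => pr P [set w | (y < Z w)%R]).

Lemma measurable_tail Z : measurable_fun setT Z -> measurable_fun setT (tail Z).
Proof.
move=> mZ; have := measurable_layers P mZ measurableT.
by move/measurable_EFinP; apply: eq_measurable_fun => y _; rewrite setTI.
Qed.

(* A nonincreasing density on (0,1) is a mixture of the uniform densities
   on the intervals (0,l); for the decreasing rearrangement of Z the
   mixing measure is the law of l = P(Z > y) when y has density P(Z > y). *)
Definition mixing Z mu := on01 mu /\ forall F : R -> \bar R,
  measurable_fun ([set` `]0%R, 1%R]] : set R) F -> (forall l, 0 <= F l) ->
  \int[mu]_(l in [set` `]0%R, 1%R]]) F l =
  \int[leb]_(y in [set` `]0%R, +oo[]) ((tail Z y)%:E * F (tail Z y)).

(** [nu] has Lebesgue density [h], of total mass [E[Z] = 1] by the tail formula, and [mu] is its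
    image under the tail function; the identity is a change of variables. *)
Lemma exists_mixing Z : density P Z -> exists mu, mixing Z mu.
Proof.
move=> [mZ Z0 Z1]; pose g := tail Z.
have mg : measurable_fun setT g by exact: measurable_tail.
have g0 y : (0 <= g y)%R by exact: pr_ge0.
have g1 y : (g y <= 1)%R by apply: pr_le1; exact: measurable_lt_set.
pose D := [set` `]0%R, +oo[] : set R.
have mD : measurable D by exact: measurable_itv.
pose h y := (g y * \1_D y)%R.
have mh : measurable_fun setT h by apply: measurable_funM => //; exact: measurable_indic.
have h0 y : (0 <= h y)%R by rewrite mulr_ge0.
have inth (f : R -> \bar R) : (forall y, 0 <= f y) ->
    \int[leb]_y ((h y)%:E * f y) = \int[leb]_(y in D) ((g y)%:E * f y).
  move=> f0; rewrite [RHS]integral_mkcond; apply: eq_integral => y _.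
  by rewrite patchE /h indicE; case: ifP => _; rewrite ?mulr1// mulr0 mul0e.
have h1 : \int[leb]_y (h y)%:E = 1.
  transitivity (\int[leb]_y ((h y)%:E * cst 1 y)).
    by apply: eq_integral => y _; rewrite mule1.
  rewrite inth//; transitivity (\int[leb]_(y in D) (g y)%:E).
    by apply: eq_integral => y _; rewrite mule1.
  by rewrite -Z1 integral_tail.
pose mg' := isMeasurableFun.Build _ _ _ _ _ mg.
pose gm : {mfun R >-> R} := HB.pack g mg'.
pose nu : probability R R := density_measure mh h0 h1.
pose mu : probability R R := distribution nu (gm : {RV nu >-> R}).
pose I01 := [set` `]0%R, 1%R]] : set R.
have mI : measurable I01 by exact: measurable_itv.
have fmu (F : R -> \bar R) : measurable_fun I01 F -> (forall l, 0 <= F l) ->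
    \int[mu]_(l in I01) F l = \int[leb]_(y in D) ((g y)%:E * F (g y)).
  move=> mF F0.
  transitivity (\int[nu]_(y in g @^-1` I01) (F \o g) y).
    by apply: ge0_integral_pushforward.
  have mgI : measurable (g @^-1` I01) by exact: measurable_preimageT.
  have mFg : measurable_fun setT ((F \o g) \_ (g @^-1` I01)).
    apply/(measurable_restrictT _ _).1 => //.
    apply: (@measurable_comp _ _ _ _ _ _ I01) => //; last exact: measurable_funTS.
    by move=> _ [y /= Iy <-].
  have Fg0 y : 0 <= ((F \o g) \_ (g @^-1` I01)) y.
    by rewrite patchE; case: ifP => _; [exact: F0|exact: lexx].
  rewrite integral_mkcond integral_density_measure// inth//.
  apply: eq_integral => y _; rewrite patchE; case: ifPn => //= /negP nI.
  (* Levels with [g y = 0] fall outside [I01] but carry no weight; all others are mapped into it. *)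
  have [gy|gy] := eqVneq (g y) 0%R; first by rewrite gy !mul0e.
  exfalso; apply: nI; apply/mem_set; rewrite /preimage/= /I01/= in_itv/= g1 andbT.
  by rewrite lt_neqAle eq_sym gy g0.
exists mu; split => //; rewrite /on01.
transitivity (\int[mu]_(l in I01) (cst 1 l)).
  by rewrite integral_cst// mul1e.
rewrite fmu// -(inth (cst 1))// -[RHS]h1.
by apply: eq_integral => y _; rewrite mule1.
Qed.

End mixture.

(** * Differences of nonnegative integrals *)

Section integral_difference.
Context {d : measure_display} {T : measurableType d} {R : realType}.
Variable m : {measure set T -> \bar R}.
Local Open Scope ereal_scope.

(** Pointwise, [p] plus the negative part of [p - q] equals [q] plus its positive part, and
    integrals may be subtracted when that of [q] is finite. Otherwise the last hypothesis makes both
    sides [-oo]. *)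
Lemma integral_pos_neg_parts (D : set T) (p q : T -> \bar R) : measurable D ->
  measurable_fun D p -> measurable_fun D q ->
  (forall x, 0 <= p x) -> (forall x, 0 <= q x) ->
  (\int[m]_(x in D) q x = +oo -> \int[m]_(x in D) maxe (- (p x - q x)) 0 = +oo) ->
  \int[m]_(x in D) maxe (p x - q x) 0 - \int[m]_(x in D) maxe (- (p x - q x)) 0 =
  \int[m]_(x in D) p x - \int[m]_(x in D) q x.
Proof.
move=> mD mp mq p0 q0 qoo.
have mpq : measurable_fun D (fun x => p x - q x) by exact: emeasurable_funB.
have mP : measurable_fun D (fun x => maxe (p x - q x) 0) by exact: measurable_maxe.
have mN : measurable_fun D (fun x => maxe (- (p x - q x)) 0).
  by apply: measurable_maxe => //; exact: measurableT_comp.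
have P0 (x : T) : D x -> 0 <= maxe (p x - q x) 0 by rewrite le_max lexx orbT.
have N0 (x : T) : D x -> 0 <= maxe (- (p x - q x)) 0 by rewrite le_max lexx orbT.
have E : \int[m]_(x in D) p x + \int[m]_(x in D) maxe (- (p x - q x)) 0 =
         \int[m]_(x in D) q x + \int[m]_(x in D) maxe (p x - q x) 0.
  rewrite -!ge0_integralD//; apply: eq_integral => x _.
  move: (p0 x) (q0 x); case: (p x) => [a| |]//; case: (q x) => [b| |]// _ _.
  - rewrite -EFinB -EFinN -!EFin_max -!EFinD; congr EFin.
    by case: (leP (a - b)%R 0%R) => h1; case: (leP (- (a - b))%R 0%R) => h2; lra.
  - by rewrite /= (max_l (leey _)) (max_r (leNye _)).
  - by rewrite /= (max_l (leey _)) (max_r (leNye _)).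
  - by rewrite /= (max_l (leey _)) (max_r (leNye _)).
have le : \int[m]_(x in D) maxe (- (p x - q x)) 0 <= \int[m]_(x in D) q x.
  apply: ge0_le_integral => // x _; rewrite ge_max q0 andbT.
  move: (p0 x) (q0 x); case: (p x) => [a| |]//; case: (q x) => [b| |]//.
  - by rewrite -EFinB -EFinN !lee_fin => a0 b0; lra.
  - by rewrite /= leNye.
move: qoo E le.
have : 0 <= \int[m]_(x in D) q x by apply: integral_ge0.
have : 0 <= \int[m]_(x in D) p x by apply: integral_ge0.
have : 0 <= \int[m]_(x in D) maxe (p x - q x) 0 by apply: integral_ge0.
have : 0 <= \int[m]_(x in D) maxe (- (p x - q x)) 0 by apply: integral_ge0.
move: (\int[m]_(x in D) maxe (- (p x - q x)) 0) => b'.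
move: (\int[m]_(x in D) maxe (p x - q x) 0) => a'.
move: (\int[m]_(x in D) p x) => a.
case: (\int[m]_(x in D) q x) => [b| |]//; last first.
  by move=> _ _ _ _ -> // _ _; case: a a' => [a| |] [a'| |].
case: b' => [b'| |]//; case: a => [a| |]//; case: a' => [a'| |]// _ _ _ _ _.
by rewrite -!EFinD => -[h] _; congr EFin; lra.
Qed.

End integral_difference.

(** * Weighted V@R utilities of mixing measures *)

Section mixture_utility.
Context {d : measure_display} {T : measurableType d} {R : realType}.
Variable P : probability T R.
Local Open Scope ereal_scope.
Implicit Types (X Z : T -> R) (mu : probability R R).

Local Notation tail Z := (fun y : R => pr P [set w | (y < Z w)%R]).

Lemma mixing_same_law Z Z' mu : same_law P Z Z' -> mixing P Z mu -> mixing P Z' mu.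
Proof.
move=> ZZ [mu01 muF]; split => // F mF F0; rewrite muF//.
by apply: eq_integral => y _; rewrite (same_law_tail ZZ).
Qed.

Section antimonotone_pair.
Variables X Z : T -> R.
Hypotheses (mX : measurable_fun setT X) (dZ : density P Z)
  (XZ : antimonotone P X Z).

Let mZ : measurable_fun setT Z. Proof. by case: dZ. Qed.
Let mNX : measurable_fun setT (fun x => - X x)%R. Proof. exact: measurable_funN. Qed.

Let A y := [set w | (y < Z w)%R].
Let g y := pr P (A y).
Let Xp x : R := Num.max (X x) 0%R.
Let Xn x : R := Num.max (- X x)%R 0%R.
Let p y := \int[P]_(x in A y) (Xp x)%:E.
Let q y := \int[P]_(x in A y) (Xn x)%:E.
Let EXn := \int[P]_x (Xn x)%:E.

Let mXp : measurable_fun setT Xp. Proof. exact: measurable_maxr. Qed.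
Let mXn : measurable_fun setT Xn. Proof. exact: measurable_maxr. Qed.
Let Xp0 x : (0 <= Xp x)%R. Proof. by rewrite le_max lexx orbT. Qed.
Let Xn0 x : (0 <= Xn x)%R. Proof. by rewrite le_max lexx orbT. Qed.
Let mA y : measurable (A y). Proof. exact: measurable_lt_set. Qed.
Let p0 y : 0 <= p y. Proof. by apply: integral_ge0 => x _; rewrite lee_fin. Qed.
Let q0 y : 0 <= q y. Proof. by apply: integral_ge0 => x _; rewrite lee_fin. Qed.
Let EXn0 : 0 <= EXn. Proof. by apply: integral_ge0 => x _; rewrite lee_fin. Qed.
Let mp : measurable_fun setT p. Proof. exact: measurable_tail_integral_EFin. Qed.
Let mq : measurable_fun setT q. Proof. exact: measurable_tail_integral_EFin. Qed.
Let g0 y : (0 <= g y)%R. Proof. exact: pr_ge0. Qed.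
Let g1 y : (g y <= 1)%R. Proof. exact: pr_le1. Qed.
Let mg : measurable_fun setT g. Proof. exact: measurable_tail. Qed.

Let C (t : R) := [set w | (t < - X w)%R].
Let mC t : measurable (C t). Proof. exact: measurable_lt_set. Qed.

Let Xn_tail (t : R) : (0 < t)%R -> [set x | (t < Xn x)%R] = C t.
Proof. exact: lt_max0_set. Qed.

Let Xp_tail (t : R) : (0 < t)%R -> [set x | (t < Xp x)%R] = [set x | (t < X x)%R].
Proof. exact: lt_max0_set. Qed.

Let D := [set` `]0%R, +oo[] : set R.
Let mD : measurable D. Proof. exact: measurable_itv. Qed.

Let q_le y : q y <= EXn.
Proof.
apply: ge0_subset_integral => //.
- exact/measurable_EFinP.
- by move=> x _; rewrite lee_fin.
Qed.

(** [X^-] and the event [Z > y] are positively correlated: on each layer one event contains the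
    other up to a null set, so the joint probability is at least the product. *)
Let q_ge y : (g y)%:E * EXn <= q y.
Proof.
rewrite /EXn /q !integral_layers// -ge0_integralZl//; first last.
- by rewrite lee_fin.
- by move=> t _; rewrite lee_fin pr_ge0.
- by apply: measurable_funTS; exact: measurable_layers.
apply: ge0_le_integral => //.
- by move=> t _; rewrite -EFinM lee_fin mulr_ge0 ?pr_ge0.
- apply: emeasurable_funM => //; apply: measurable_funTS; exact: measurable_layers.
- by apply: measurable_funTS; exact: measurable_layers.
move=> t; rewrite /= in_itv/= andbT => t0; rewrite -EFinM lee_fin Xn_tail// setTI setIC.
have C0 := pr_ge0 P (C t); have C1 := pr_le1 P (mC t).
have [->|->] := @antimonotone_lower_tails _ _ _ P X Z t y mX mZ XZ.
  by rewrite ler_piMl.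
by rewrite ler_piMr// g0.
Qed.

(** If [X < 0] has positive probability, [P(Z > y)] eventually falls below it; by nesting, [Z > y]
    then lies in [X < 0] up to a null set, where [X^+] vanishes. *)
Let p_eq0 : 0 < EXn -> exists2 y0 : R, (0 < y0)%R & forall y, (y0 <= y)%R -> p y = 0.
Proof.
move=> EXn_gt0; have C0 : (0 < pr P (C 0))%R.
  rewrite lt_neqAle pr_ge0 andbT; apply/negP => /eqP C0.
  move: EXn_gt0; rewrite /EXn integral_layers// integral0_eq ?ltxx//.
  move=> t; rewrite /= in_itv/= andbT => t0; rewrite Xn_tail// setTI; congr EFin.
  apply/eqP; rewrite eq_le pr_ge0 andbT C0; apply: pr_le => // x /=.
  exact: lt_trans.
have [n gn] : exists n : nat, (g n%:R < pr P (C 0))%R.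
  apply: contrapT => h; have : (pr P (C 0) <= 0)%R; last by rewrite leNgt C0.
  rewrite -[leRHS](pr0 P).
  have -> : set0 = \bigcap_n A n%:R.
    apply/esym; rewrite -subset0 => v /(_ (Num.truncn (Z v)).+1 I).
    by rewrite /A/= ltNge => /negP; apply; rewrite ltW// truncnS_gt.
  apply: pr_bigcap_ge => // [i j ij|n].
    by apply/subsetPset => v /=; apply: le_lt_trans; rewrite ler_nat.
  by rewrite leNgt; apply/negP => h'; apply: h; exists n.
(* The successor makes the threshold positive even for [n = 0]. *)
exists n.+1%:R => // y ny; rewrite /p integral_layers// integral0_eq//.
move=> t; rewrite /= in_itv/= andbT => t0; rewrite Xp_tail//; congr EFin.
have Ay : (pr P (A y) < pr P (C 0))%R.
  apply: le_lt_trans gn; apply: pr_le => // x /=; apply: le_lt_trans.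
  by rewrite (le_trans _ ny)// ler_nat.
have AC : (pr P (A y `&` C 0) <= pr P (A y))%R.
  by apply: pr_le => //; exact: measurableI.
have [E|E] := @antimonotone_lower_tails _ _ _ P X Z 0%R y mX mZ XZ.
  by move: AC; rewrite setIC -/(A y) -/(C 0) in E *; rewrite E leNgt Ay.
apply/eqP; rewrite eq_le pr_ge0 andbT.
have := prDI P (mA y) (mC 0); rewrite setIC -/(A y) -/(C 0) in E *; rewrite E => AD.
apply: (@le_trans _ _ (pr P (A y `\` C 0))); last lra.
apply: pr_le; [|exact: measurableD|].
  by apply: measurableI => //; exact: measurable_lt_set.
by move=> x [Ax /= tx]; split => //=; apply/negP; rewrite -leNgt oppr_le0 ltW// (lt_trans t0).
Qed.

Let intg : \int[leb]_(y in D) (g y)%:E = 1.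
Proof.
by have [_ Z0 <-] := dZ; rewrite integral_tail.
Qed.

(* If E[X^-] is infinite then so is q y whenever g y > 0; otherwise q is
   bounded, so its mass at infinity diverges, where p vanishes. *)
Let neg_part_infinite : \int[leb]_(y in D) q y = +oo ->
  \int[leb]_(y in D) maxe (- (p y - q y)) 0 = +oo.
Proof.
move=> qoo; set N := fun y => maxe (- (p y - q y)) 0.
have mN : measurable_fun D N.
  apply: measurable_funTS; apply: measurable_maxe => //.
  by apply: measurableT_comp => //; exact: emeasurable_funB.
have N0 y : 0 <= N y by rewrite le_max lexx orbT.
apply/eqP; rewrite eq_le leey /=.
have [EXoo|EXfin] := eqVneq EXn +oo.
  apply: (@le_trans _ _ (\int[leb]_(y in D) (+oo * (g y)%:E))).
    rewrite ge0_integralZl//.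
    - by rewrite intg mule1.
    - by apply: measurable_funTS; exact/measurable_EFinP.
    - by move=> y _; rewrite lee_fin.
  apply: ge0_le_integral => //.
  - by move=> y _; rewrite mule_ge0// lee_fin.
  - apply: emeasurable_funM => //; apply: measurable_funTS; exact/measurable_EFinP.
  move=> y _; have [gy|gy] := eqVneq (g y) 0%R; first by rewrite gy mule0 le_max lexx orbT.
  have gy0 : (0 < g y)%R by rewrite lt_neqAle eq_sym gy g0.
  have := q_ge y; rewrite EXoo gt0_muley ?lte_fin// leye_eq => /eqP qy.
  by rewrite /N qy; case: (p y) => [r| |]; rewrite /= max_l ?leey.
(* [EXn = 0] would force [q = 0], against [qoo]. *)
have [y0 y00 py0] : exists2 y0 : R, (0 < y0)%R & forall y, (y0 <= y)%R -> p y = 0.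
  apply: p_eq0; rewrite lt_neqAle EXn0 andbT; apply/negP => /eqP EX0.
  move: qoo; rewrite integral0_eq// => y _; apply/eqP.
  by rewrite eq_le q0 andbT (le_trans (q_le y))// -EX0.
have mi : measurable_fun D (fun y => EXn * (\1_(`]0%R, y0[%classic : set R) y)%:E).
  apply: emeasurable_funM => //; apply: measurable_funTS.
  by apply/measurable_EFinP; exact: measurable_indic.
have i0 y : 0 <= EXn * (\1_(`]0%R, y0[%classic : set R) y)%:E.
  by rewrite mule_ge0// lee_fin.
(* Below [y0] the bound [EXn] on [q] suffices; from [y0] on [p = 0], hence [N = q]. The last
   integral is the finite number [EXn * y0]. *)
have : \int[leb]_(y in D) q y <= \int[leb]_(y in D) N y +
    \int[leb]_(y in D) (EXn * (\1_(`]0%R, y0[%classic : set R) y)%:E).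
  rewrite -ge0_integralD//; apply: ge0_le_integral => //.
  - exact: measurable_funTS.
  - exact: emeasurable_funD.
  move=> y; rewrite /D/= in_itv/= andbT => y_gt0; have [yy|yy] := ltP y y0.
    rewrite indicE mem_set/= ?in_itv/= ?y_gt0// mule1 -[leLHS]add0e.
    by apply: leeD => //; exact: q_le.
  rewrite indicE memNset/= ?in_itv/= ?y_gt0/= ?ltNge ?yy// mule0 adde0 /N py0//.
  by rewrite add0e oppeK le_max lexx.
rewrite qoo ge0_integralZl//; last first.
  by apply: measurable_funTS; apply/measurable_EFinP; exact: measurable_indic.
rewrite integral_indic// setIidl; last by move=> y; rewrite /D/= !in_itv/= => /andP[->].
rewrite [X in _ * X](leb_itv `]0%R, y0[)/= lte_fin y00 sube0.
have : EXn \is a fin_num by rewrite ge0_fin_numE// ltey.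
move=> /fineK <-; rewrite -EFinM.
by case: (\int[leb]_(y in D) N y) => [r| |].
Qed.

(** Where [P(Z > y) = 0] both sides vanish, since 0 times any extended real is 0. *)
Let level_ulam y : (g y)%:E * ulam P (g y) X = p y - q y.
Proof.
have [gy|gy] := eqVneq (g y) 0%R; last first.
  by apply: ulam_antimonotone => //; rewrite lt_neqAle eq_sym gy pr_ge0.
have PA : P (A y) = 0 by rewrite prE// -/(g y) gy.
rewrite gy mul0e /p /q !null_set_integral ?sube0//.
- by apply: measurable_funTS; exact/measurable_EFinP.
- by apply: measurable_funTS; exact/measurable_EFinP.
Qed.

Let mule_maxe0 (r : R) (x : \bar R) : (0 <= r)%R ->
  r%:E * maxe x 0 = maxe (r%:E * x) 0.
Proof. by move=> r0; rewrite maxe_pMr ?mule0 ?lee_fin. Qed.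

(** [level_ulam] is integrated over [y]; the layer cake in [Z] with weights [X^+] and [X^-] then
    returns the two parts of [EQ P Z X]. *)
Lemma umu_antimonotone mu : mixing P Z mu -> umu P mu X = EQ P Z X.
Proof.
move=> [_ muF]; have mu_ := @measurable_ulam _ _ _ P X.
rewrite /umu !muF; first last.
- by move=> l; rewrite le_max lexx orbT.
- exact: measurable_maxe.
- by move=> l; rewrite le_max lexx orbT.
- by apply: measurable_maxe => //; exact: measurableT_comp.
transitivity (\int[leb]_(y in D) maxe (p y - q y) 0 -
              \int[leb]_(y in D) maxe (- (p y - q y)) 0).
  congr (_ - _); apply: eq_integral => y _.
    by rewrite mule_maxe0 ?pr_ge0// level_ulam.
  by rewrite mule_maxe0 ?pr_ge0// muleN level_ulam.
rewrite (integral_pos_neg_parts mD (measurable_funTS mp) (measurable_funTS mq)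
  p0 q0 neg_part_infinite).
have [_ Z0 _] := dZ; rewrite (EQ_max0 mZ mX Z0) /EQ.
congr (_ - _).
  rewrite -(layer_cake_EFin P mXp mZ Xp0).
  by apply: eq_integral => x _; rewrite mulrC.
rewrite -(layer_cake_EFin P mXn mZ Xn0).
by apply: eq_integral => x _; rewrite mulrC.
Qed.

End antimonotone_pair.

(** The copy of [Z] antimonotone to [X] has the same mixing measure, so [umu P mu X] is its
    expectation, the least among copies by Hardy-Littlewood. *)
Lemma umu_le_EQ Z mu X : atomless P -> density P Z -> mixing P Z mu ->
  measurable_fun setT X -> umu P mu X <= EQ P Z X.
Proof.
move=> aP dZ muZ mX; have [mZ Z0 _] := dZ.
have [Z' [mZ' ZZ XZ']] := exists_antimonotone aP mX mZ.
have dZ' := same_law_density dZ mZ' ZZ.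
rewrite (umu_antimonotone mX dZ' XZ' (mixing_same_law ZZ muZ)).
exact: hardy_littlewood.
Qed.

(** The antimonotone copy of [Z] stays in the determining set, so its expectation of [X], namely
    [umu P mu X], bounds [u X]. *)
Lemma detset_le_umu u Z mu X : atomless P -> law_invariant_set P (detset P u) ->
  detset P u Z -> mixing P Z mu -> measurable_fun setT X -> u X <= umu P mu X.
Proof.
move=> aP lD DZ muZ mX; have [dZ _] := DZ; have [mZ _ _] := dZ.
have [Z' [mZ' ZZ XZ']] := exists_antimonotone aP mX mZ.
have [dZ' uZ'] := lD _ _ DZ mZ' ZZ.
rewrite (umu_antimonotone mX dZ' XZ' (mixing_same_law ZZ muZ)); exact: uZ'.
Qed.

End mixture_utility.

(** * Equivalence of the four conditions *)

Local Open Scope ereal_scope.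

Theorem theoremA1 (d : measure_display) (T : measurableType d) (R : realType)
  (P : probability T R) (u : (T -> R) -> \bar R) :
  atomless P -> coherent_utility P u ->
  (law_invariant_u P u <-> law_invariant_set P (detset P u)) /\
  (law_invariant_u P u <->
     exists M : set (probability R R), (forall mu, M mu -> on01 mu) /\
       forall X, measurable_fun setT X ->
         u X = ereal_inf [set umu P mu X | mu in M]) /\
  (law_invariant_u P u <->
     exists M : set (probability R R), (forall mu, M mu -> on01 mu) /\
       detset P u = \bigcup_(mu in M) detset P (umu P mu)).
Proof.
move=> aP cu.
(* One family serves for both (iii) and (iv). *)
pose M := [set mu : probability R R | exists2 Z, detset P u Z & mixing P Z mu].
have M01 mu : M mu -> on01 mu by move=> [Z _ []].
have exM Z : detset P u Z -> exists2 mu, M mu & mixing P Z mu.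
  by move=> DZ; have [mu muZ] := exists_mixing DZ.1; exists mu => //; exists Z.
split; [|split]; split.
- exact: detset_law_invariant.
- exact: law_invariant_detset.
- move=> /(detset_law_invariant aP) lD; exists M; split => // X mX.
  apply/eqP; rewrite eq_le; apply/andP; split.
    apply: le_ereal_inf_tmp => _ [mu [Z DZ muZ] <-].
    exact: detset_le_umu DZ muZ mX.
  rewrite (coherent_utility_detset cu mX); apply: le_ereal_inf_tmp => _ [Z DZ <-].
  have [mu Mmu muZ] := exM _ DZ.
  apply: le_trans (umu_le_EQ aP DZ.1 muZ mX).
  by apply: ereal_inf_lbound; exists mu.
(* An infimum of law invariant utilities is law invariant. *)
- move=> [N [_ uN]] X X' mX mX' XX; rewrite (uN X mX) (uN X' mX').
  have E mu : umu P mu X = umu P mu X' by exact: umu_law_invariant.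
  have EN : [set umu P mu X | mu in N] = [set umu P mu X' | mu in N].
    apply/seteqP; split => _ [mu Nmu <-].
      exact: (ex_intro2 _ _ mu Nmu (esym (E mu))).
    exact: (ex_intro2 _ _ mu Nmu (E mu)).
  exact: (f_equal (@ereal_inf R) EN).
- move=> /(detset_law_invariant aP) lD; exists M; split => //.
  (* Forwards, [Z] lies in the determining set of its own mixture; backwards, [u <= umu P mu] makes
     every member for [umu P mu] a member for [u]. *)
  apply/seteqP; split => [Z DZ|W [mu [Z DZ muZ] [dW uW]]].
    have [mu Mmu muZ] := exM _ DZ; exists mu => //; split; first exact: DZ.1.
    by move=> X mX; exact: umu_le_EQ DZ.1 muZ mX.
  split => // X mX; apply: le_trans (uW _ mX).
  exact: detset_le_umu DZ muZ mX.
(* A union of law invariant sets is law invariant. *)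
- move=> [N [_ DN]]; apply: law_invariant_detset => // Z Z'.
  rewrite DN => -[mu Nmu DZ] mZ' ZZ; exists mu => //.
  exact: detset_law_invariant (umu_law_invariant mu aP) _ _ DZ mZ' ZZ.
Qed.
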